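(* Let $n=2m+1$ where $m\geq2$, and let $C_n$ denote the cyclic graph on $n$ vertices. Then the magnitude cohomology ring $\mathrm{MH}^*_*(C_n)$ is the bigraded associative ring with the following presentation. The generators are: \begin{itemize} \item $e_x\in\mathrm{MH}^0_0(C_n)$ for vertices $x$ of $C_n$; \item $a_{xy}\in\mathrm{MH}^1_1(C_n)$ for oriented edges $xy$ of $C_n$; \item $b_{xz}\in\mathrm{MH}^2_{m+1}(C_n)$ for ordered pairs $x,z$ of vertices with $d(x,z)=m$. \end{itemize} The relations are: \begin{itemize} \item $e_x^2=e_x$ for every vertex $x$; \item $e_xe_y=0$ for distinct vertices $x,y$; \item $a_{xy}=e_xa_{xy}=a_{xy}e_y$ for every oriented edge $xy$; \item $b_{xz}=e_xb_{xz}=b_{xz}e_z$ for every $x,z$ with $d(x,z)=m$; \item $a_{xy}a_{yz}=0$ if $xy$ and $yz$ are oriented edges with $x\neq z$; \item $a_{wx}b_{xz}=b_{wy}a_{yz}$ for every $w,x,y,z$ in cyclic order (clockwise or anticlockwise) with $d(w,x)=1$, $d(x,y)=m$, $d(y,z)=1$, i.e. for every vertex $w$ and every $\varepsilon\in\{1,-1\}$, with $x=w+\varepsilon$, $y=x+\varepsilon m$, $z=y+\varepsilon$. \end{itemize}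
   Context: $C_n$ has vertex set $\mathbb{Z}/n$, with $x,y$ adjacent if and only if $x-y=\pm1$, regarded as a metric space with the shortest-path metric $d$. An oriented edge $xy$ is an ordered pair of adjacent vertices. ''Bigraded associative ring with the given presentation'' means the free associative (not assumed unital) ring on the generators, modulo the two-sided ideal generated by the relations, bigraded by placing $e_x,a_{xy},b_{xz}$ in bidegrees $(k,\ell)=(0,0),(1,1),(2,m+1)$ respectively (it turns out to have unit $\sum_xe_x$). Magnitude cohomology ring of a metric space $X$ with metric $d$: a $k$-simplex ($k\ge 0$) in $X$ is a tuple $(x_0,\ldots,x_k)\in X^{k+1}$ with $x_{i-1}\neq x_i$ for all $i$; its length is $\ell(x_0,\ldots,x_k)=d(x_0,x_1)+\cdots+d(x_{k-1},x_k)$. For $\ell\in[0,\infty)$, $\mathrm{MC}_{k,\ell}(X)$ is the free abelian group on the $k$-simplices of length $\ell$, with differential $\partial=\sum_{i=1}^{k-1}(-1)^i\partial_i\colon \mathrm{MC}_{k,\ell}(X)\to\mathrm{MC}_{k-1,\ell}(X)$, where $\partial_i(x_0,\ldots,x_k)=(x_0,\ldots,\widehat{x_i},\ldots,x_k)$ if $d(x_{i-1},x_{i+1})=d(x_{i-1},x_i)+d(x_i,x_{i+1})$ and $0$ otherwise. The magnitude cochain complex is $\mathrm{MC}^k_\ell(X)=\mathrm{Hom}(\mathrm{MC}_{k,\ell}(X),\mathbb{Z})$ with differential $\partial^*\varphi=\varphi\circ\partial$, and $\mathrm{MH}^k_\ell(X)=H^k(\mathrm{MC}^*_\ell(X))$.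 For $\varphi\in\mathrm{MC}^{k_1}_{\ell_1}(X)$ and $\psi\in\mathrm{MC}^{k_2}_{\ell_2}(X)$, the product $\varphi\cdot\psi\in\mathrm{MC}^{k_1+k_2}_{\ell_1+\ell_2}(X)$ sends a simplex $(x_0,\ldots,x_{k_1+k_2})$ of length $\ell_1+\ell_2$ to $\varphi(x_0,\ldots,x_{k_1})\,\psi(x_{k_1},\ldots,x_{k_1+k_2})$ if $\ell(x_0,\ldots,x_{k_1})=\ell_1$ and $\ell(x_{k_1},\ldots,x_{k_1+k_2})=\ell_2$, and to $0$ otherwise. The unit is the cochain $u\in\mathrm{MC}^0_0(X)$ with $u(x_0)=1$ for every $0$-simplex. This makes $\mathrm{MH}^*_*(X)$ into an associative unital bigraded ring. *)

(* Defs.v *)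
From HB Require Import structures.
From mathcomp Require Import all_boot all_order all_algebra.
From mathcomp Require Import finmap.
From mathcomp Require Import boolp reals.
From mathcomp Require Import xfinmap monalg.

Set Implicit Arguments.
Unset Strict Implicit.
Unset Printing Implicit Defensive.

Import GRing.Theory.
Local Open Scope ring_scope.
Local Open Scope quotient_scope.

Section Hom.
Variables U V : zmodType.

Local Notation Hom := {additive U -> V}.

HB.instance Definition _ := gen_eqMixin Hom.
HB.instance Definition _ := gen_choiceMixin Hom.

Lemma homP (f g : Hom) : f =1 g -> f = g.
Proof.
case: f g => [f [[Hf]]] [g [[Hg]]] /= fg.
have {}fg : f = g by apply/funext.
by case: _ / fg Hg => Hg; rewrite (Prop_irrelevance Hf Hg).
Qed.

Definition hom0 : Hom := \0.
Definition homN (f : Hom) : Hom := \- f.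
Definition homD (f g : Hom) : Hom := f \+ g.

Fact homDA : associative homD.
Proof. by move=> f g h; apply: homP => x; exact: addrA. Qed.
Fact homDC : commutative homD.
Proof. by move=> f g; apply: homP => x; exact: addrC. Qed.
Fact hom0D : left_id hom0 homD.
Proof. by move=> f; apply: homP => x; exact: add0r. Qed.
Fact homND : left_inverse hom0 homN homD.
Proof. by move=> f; apply: homP => x; exact: addNr. Qed.
HB.instance Definition _ := GRing.isZmodule.Build Hom homDA homDC hom0D homND.

Lemma homDE (f g : Hom) x : (f + g) x = f x + g x. Proof. by []. Qed.
Lemma homNE (f : Hom) x : (- f) x = - f x. Proof. by []. Qed.
Lemma hom0E x : (0 : Hom) x = 0. Proof. by []. Qed.
Lemma homMnE (f : Hom) n x : (f *+ n) x = f x *+ n.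
Proof. by elim: n => // n IH; rewrite !mulrS homDE IH. Qed.
Lemma homMzE (f : Hom) z x : (f *~ z) x = f x *~ z.
Proof. by case: z => n; rewrite ?NegzE ?mulrNz ?homNE -!pmulrn homMnE. Qed.
End Hom.

Section FreeAbelian.
Variables (S : choiceType) (V : zmodType).

(* {malg S} is the free abelian group on S; [fgext h] is the additive
   extension of h. *)
Definition fgext_fun (h : S -> V) (c : {malg S}) : V :=
  \sum_(s <- msupp c) h s *~ c@_s.

Lemma fgext_funEw (h : S -> V) (D : {fset S}) c : (msupp c `<=` D)%fset ->
  fgext_fun h c = \sum_(s <- D) h s *~ c@_s.
Proof.
move=> le; rewrite /fgext_fun (big_fset_incl _ le) //= => x _ /mcoeff_outdom ->.
by rewrite mulr0z.
Qed.

Fact fgext_is_zmod_morphism h : zmod_morphism (fgext_fun h).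
Proof.
move=> c1 c2 /=.
set D := (msupp c1 `|` msupp c2)%fset.
rewrite !(fgext_funEw h (D := D)) ?fsubsetUl ?fsubsetUr ?msuppB_le //.
by rewrite -sumrB; apply: eq_bigr => s _; rewrite mcoeffB mulrzBr.
Qed.
HB.instance Definition _ h :=
  GRing.isZmodMorphism.Build {malg S} V (fgext_fun h)
    (fgext_is_zmod_morphism h).

Definition fgext (h : S -> V) : {additive {malg S} -> V} := fgext_fun h.

Lemma fgextU h s : fgext h << s >> = h s.
Proof.
rewrite /fgext /= (fgext_funEw h (D := [fset s]%fset)) ?msuppU_le //.
by rewrite big_seq_fset1 mcoeffUU.
Qed.

Lemma hom_malgP (f g : {additive {malg S} -> V}) :
  (forall s, f << s >> = g << s >>) -> f = g.
Proof.
move=> fg; apply: homP => c; rewrite (monalgE c) !raddf_sum /=.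
apply: eq_bigr => s _.
have -> : << c@_s *g s >> = << s >> *~ c@_s :> {malg S}.
  apply/malgP => t; rewrite raddfMz /= !mcoeffU.
  by case: eqP => _; rewrite ?mulr0n ?mul0rz // !mulr1n intz.
by rewrite !raddfMz /= fg.
Qed.
End FreeAbelian.

Section MagnitudeCohomology.
Variables (R : realType) (X : choiceType) (d : X -> X -> R).

Definition path_length (s : seq X) : R := \sum_(p <- zip s (behead s)) d p.1 p.2.

Definition is_simplex (k : nat) (l : R) (s : seq X) : bool :=
  [&& size s == k.+1, sorted (fun x y => x != y) s & path_length s == l].

(* l ranges over all of R: no simplex has negative length, so the groups
   below vanish for l < 0. *)
Definition simplex (k : nat) (l : R) := {s : seq X | is_simplex k l s}.

Definition chain (k : nat) (l : R) := {malg simplex k l}.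

Definition face (i : nat) (s : seq X) : seq X := take i s ++ drop i.+1 s.

(* d(x_{i-1}, x_{i+1}) = d(x_{i-1}, x_i) + d(x_i, x_{i+1}), for 0 < i < k. *)
Definition geodesic_at (i : nat) (s : seq X) : bool :=
  if drop i.-1 s is [:: x, y, z & _] then d x z == d x y + d y z else false.

Definition simplex_chain k l (s : seq X) : chain k l :=
  if insub s is Some t then << (t : simplex k l) >> else 0.

(* When d is a metric and geodesic_at i s holds, face i s is again a simplex
   of length l, so the default value of simplex_chain is not used here. *)
Definition face_chain k l (i : nat) (s : simplex k.+1 l) : chain k l :=
  if geodesic_at i (val s) then simplex_chain k l (face i (val s)) else 0.

Definition boundary k l : {additive chain k.+1 l -> chain k l} :=
  fgext (fun s : simplex k.+1 l =>
    \sum_(1 <= i < k.+1) face_chain i s *~ (-1) ^+ i).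

Definition cochain (k : nat) (l : R) := {additive chain k l -> int}.
HB.instance Definition _ k l := GRing.Zmodule.on (cochain k l).

Definition cobound k l (phi : cochain k l) : cochain k.+1 l :=
  phi \o boundary k l.

(* The chain (x_0, ..., x_k) is sent to 0 unless it has degree k and length l;
   this is the "0 otherwise" clause of the product. *)
Definition cup_fun k1 l1 k2 l2 (phi : cochain k1 l1) (psi : cochain k2 l2)
    (s : simplex (k1 + k2)%N (l1 + l2)) : int :=
  phi (simplex_chain k1 l1 (take k1.+1 (val s)))
  * psi (simplex_chain k2 l2 (drop k1 (val s))).

Definition cup k1 l1 k2 l2 (phi : cochain k1 l1) (psi : cochain k2 l2) :
    cochain (k1 + k2)%N (l1 + l2) :=
  fgext (cup_fun phi psi).

Definition is_cocycle k l : {pred cochain k l} :=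
  [pred phi | cobound phi == 0].

Definition is_coboundary k l : cochain k l -> Prop :=
  match k with
  | 0 => fun phi => phi = 0
  | _.+1 => fun phi => exists psi, phi = cobound psi
  end.

Let neqr := fun x y : X => x != y.

Lemma path_length_cat t1 x t2 :
  path_length (t1 ++ x :: t2) = path_length (rcons t1 x) + path_length (x :: t2).
Proof.
rewrite /path_length; elim: t1 => [|y t1 IH] /=; first by rewrite big_nil add0r.
by case: t1 IH => [|z t1] IH /=; rewrite !big_cons /= ?big_nil ?addr0 // IH addrA.
Qed.

Lemma sorted_cat_cons t1 x t2 :
  sorted neqr (t1 ++ x :: t2) = sorted neqr (rcons t1 x) && sorted neqr (x :: t2).
Proof. by case: t1 => [|y t1] //=; rewrite cat_path rcons_path /= andbA. Qed.

Lemma split_at (i : nat) (s : seq X) : (i < size s)%N ->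
  exists s1 x s2, s = s1 ++ x :: s2 /\ size s1 = i.
Proof.
move=> lt; exists (take i s); case E: (drop i s) => [|x s2].
  by move/(congr1 size): E; rewrite size_drop => /eqP; rewrite subn_eq0 leqNgt lt.
by exists x, s2; rewrite -E cat_take_drop size_takel // ltnW.
Qed.

Lemma simplex_chainK k l (s : simplex k l) : simplex_chain k l (val s) = << s >>.
Proof. by rewrite /simplex_chain valK. Qed.

Lemma simplex_chainN k l s : is_simplex k l s = false -> simplex_chain k l s = 0.
Proof. by move=> h; rewrite /simplex_chain insubF. Qed.

Lemma is_simplex_split k1 l1 k2 l2 t :
  is_simplex k1 l1 (take k1.+1 t) -> is_simplex k2 l2 (drop k1 t) ->
  is_simplex (k1 + k2) (l1 + l2) t.
Proof.
case/and3P => st1 so1 l1E /and3P[st2 so2 l2E].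
have lt : (k1 < size t)%N.
  by rewrite ltnNge; apply/negP => le; rewrite drop_oversize in st2.
have [s1 [x [s2 [tE sE]]]] := split_at lt.
have tkE : take k1.+1 t = rcons s1 x.
  by rewrite tE -cat_rcons take_size_cat // size_rcons sE.
have drE : drop k1 t = x :: s2 by rewrite tE drop_size_cat.
rewrite tkE in st1 so1 l1E; rewrite drE in st2 so2 l2E.
apply/and3P; split.
- rewrite tE size_cat sE (eqP st2).
  by rewrite addnS.
- by rewrite tE sorted_cat_cons so1.
- by rewrite tE path_length_cat (eqP l1E) (eqP l2E).
Qed.

Lemma cupE k1 l1 k2 l2 (phi : cochain k1 l1) (psi : cochain k2 l2) t :
  cup phi psi (simplex_chain _ _ t) =
  phi (simplex_chain k1 l1 (take k1.+1 t)) * psi (simplex_chain k2 l2 (drop k1 t)).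
Proof.
case E: (is_simplex (k1 + k2) (l1 + l2) t).
  have -> : t = val (exist (is_simplex (k1 + k2) (l1 + l2)) t E) by [].
  by rewrite simplex_chainK fgextU.
rewrite simplex_chainN // raddf0.
case E1: (is_simplex k1 l1 (take k1.+1 t)); last first.
  by rewrite [X in phi X]simplex_chainN // raddf0 mul0r.
case E2: (is_simplex k2 l2 (drop k1 t)); last first.
  by rewrite [X in psi X]simplex_chainN // raddf0 mulr0.
by rewrite (is_simplex_split E1 E2) in E.
Qed.

Lemma split_geodesic (i : nat) (s : seq X) : (0 < i)%N -> geodesic_at i s ->
  exists s1 x y z s2, [/\ s = s1 ++ [:: x, y, z & s2], size s1 = i.-1,
    face i s = s1 ++ [:: x, z & s2] & d x z = d x y + d y z].
Proof.
move=> i0; rewrite /geodesic_at.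
case E: (drop i.-1 s) => [|x [|y [|z s2]]] //= /eqP dE.
have szs : size (take i.-1 s) = i.-1.
  apply: size_takel; rewrite leqNgt; apply/negP => lt.
  by rewrite drop_oversize // ltnW in E.
have sE : s = take i.-1 s ++ [:: x, y, z & s2] by rewrite -E cat_take_drop.
exists (take i.-1 s), x, y, z, s2; split => //.
move: (take i.-1 s) szs sE => s1; case: i i0 {E} => // i _ /= <- ->.
rewrite /face -cat_rcons take_size_cat ?drop_cat ?size_rcons //.
by rewrite ltnNge leqnSn /= subSn // subnn /= ?drop0 ?cat_rcons.
Qed.

Lemma is_simplex_face k l i (s : seq X) : (0 < i)%N -> sorted neqr s ->
  size s = k.+2 -> geodesic_at i s -> is_simplex k l (face i s) ->
  is_simplex k.+1 l s.
Proof.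
move=> i0 so sz /(split_geodesic i0)[s1 [x [y [z [s2 [sE _ -> dE]]]]]].
case/and3P => _ _ /eqP lE; apply/and3P; split => //; first by rewrite sz.
rewrite -lE sE !path_length_cat; apply/eqP; congr (_ + _).
by rewrite /path_length /= !big_cons /= dE addrA.
Qed.

Lemma coboundE k l (phi : cochain k l) t : sorted neqr t -> size t = k.+2 ->
  cobound phi (simplex_chain k.+1 l t) =
  \sum_(1 <= i < k.+1)
    (if geodesic_at i t then phi (simplex_chain k l (face i t)) else 0)
      *~ (-1) ^+ i.
Proof.
move=> so sz; case E: (is_simplex k.+1 l t).
  have -> : t = val (exist (is_simplex k.+1 l) t E) by [].
  rewrite simplex_chainK /cobound /= /boundary fgextU raddf_sum.
  apply: eq_bigr => i _; rewrite raddfMz /face_chain /=.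
  by case: ifP => //; rewrite raddf0.
rewrite simplex_chainN // raddf0 big_nat big1 // => i /andP[i0 _].
case: ifP => [g|_]; rewrite ?mul0rz // simplex_chainN ?raddf0 ?mul0rz //.
by apply: contraFF E; apply: is_simplex_face g.
Qed.

Lemma geodesic_at_take k i (t : seq X) : (0 < i <= k)%N ->
  geodesic_at i (take k.+2 t) = geodesic_at i t.
Proof.
case: i => // i /= ik; rewrite /geodesic_at /=.
have -> : k.+2 = ((k - i.+1).+3 + i)%N by rewrite !addSn -addnS subnK.
by rewrite -take_drop; case: (drop i t) => [|x [|y [|z u]]].
Qed.

Lemma geodesic_at_drop k i (t : seq X) : (0 < i)%N ->
  geodesic_at (i + k) t = geodesic_at i (drop k t).
Proof. by case: i => // i _; rewrite /geodesic_at drop_drop addSn. Qed.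

Lemma take_face_l k i (t : seq X) : (i <= k)%N -> (k < size t)%N ->
  take k.+1 (face i t) = face i (take k.+2 t).
Proof.
move=> ik kt; rewrite /face take_cat size_takel ?(leq_trans ik) ?(ltnW kt) //.
rewrite ltnNge (leq_trans ik) //= take_drop take_takel; last first.
  by rewrite (leq_trans ik) // -addn2 leq_addr.
by rewrite addnS subnK // (leq_trans ik).
Qed.

Lemma drop_face_l k i (t : seq X) : (i <= k)%N -> (k < size t)%N ->
  drop k (face i t) = drop k.+1 t.
Proof.
move=> ik kt; rewrite /face drop_cat size_takel ?(leq_trans ik) ?(ltnW kt) //.
by rewrite ltnNge ik /= drop_drop addnS subnK.
Qed.

Lemma take_face_r k i (t : seq X) : (0 < i)%N -> (i + k <= size t)%N ->
  take k.+1 (face (i + k) t) = take k.+1 t.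
Proof.
move=> i0 ikt; have ki : (k < i + k)%N by rewrite -[X in (X < _)%N]add0n ltn_add2r.
rewrite /face take_cat size_takel //.
case: ltnP => [lt|le]; first by rewrite take_takel // ltnW.
have -> : (i + k)%N = k.+1 by apply/eqP; rewrite eqn_leq le.
by rewrite subnn take0 cats0.
Qed.

Lemma drop_face_r k i (t : seq X) : (0 < i)%N -> (i + k <= size t)%N ->
  drop k (face (i + k) t) = face i (drop k t).
Proof.
move=> i0 ikt; have ki : (k < i + k)%N by rewrite -[X in (X < _)%N]add0n ltn_add2r.
by rewrite /face drop_cat size_takel // ki take_drop drop_drop addSn.
Qed.

Lemma cobound_cup k1 l1 k2 l2 (phi : cochain k1 l1) (psi : cochain k2 l2)
    (s : simplex (k1 + k2).+1 (l1 + l2)) :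
  cobound (cup phi psi) << s >> =
    cobound phi (simplex_chain k1.+1 l1 (take k1.+2 (val s)))
      * psi (simplex_chain k2 l2 (drop k1.+1 (val s)))
  + phi (simplex_chain k1 l1 (take k1.+1 (val s)))
      * cobound psi (simplex_chain k2.+1 l2 (drop k1 (val s))) * (-1) ^+ k1.
Proof.
have /and3P[/eqP sz so _] := valP s; rewrite -simplex_chainK.
move: (val s) sz so => t sz so {s}.
rewrite !coboundE //; first last.
- by rewrite size_takel // sz !ltnS leq_addr.
- exact: take_sorted.
- by rewrite size_drop sz -!addnS addKn.
- exact: drop_sorted.
rewrite (big_cat_nat (n := k1.+1)) //=; last by rewrite ltnS leq_addr.
congr (_ + _).
  rewrite big_distrl /= !big_nat; apply: eq_bigr => i /andP[i0 ik].
  rewrite cupE mulrzAl; congr (_ *~ _).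
  have k1t : (k1 < size t)%N by rewrite sz !ltnS -addnS leq_addr.
  rewrite geodesic_at_take ?i0 // take_face_l // drop_face_l //.
  by case: ifP => // _; rewrite mul0r.
rewrite -{1}add1n big_addn subSn ?leq_addr // addKn big_distrr big_distrl /=.
rewrite !big_nat; apply: eq_bigr => i /andP[i0 ik].
have ikt : (i + k1 <= size t)%N.
  by rewrite sz addnC -!addnS leq_add2l ltnW // ltnW.
rewrite cupE geodesic_at_drop // take_face_r // drop_face_r //.
rewrite exprD; case: ifP => _; last by rewrite !mul0rz mulr0 mul0r.
by rewrite !mulrzz !mulrA.
Qed.

Fact coboundB k l : zmod_morphism (@cobound k l).
Proof. by move=> f g; apply: homP => c. Qed.
HB.instance Definition _ k l :=
  GRing.isZmodMorphism.Build (cochain k l) (cochain k.+1 l) (@cobound k l)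
    (@coboundB k l).

Fact is_cocycle_zmod_closed k l : zmod_closed (@is_cocycle k l).
Proof.
split=> [|f g]; rewrite !inE ?raddf0 // => /eqP f0 /eqP g0.
by rewrite raddfB /= f0 g0 subr0.
Qed.
HB.instance Definition _ k l :=
  GRing.isZmodClosed.Build (cochain k l) (@is_cocycle k l)
    (@is_cocycle_zmod_closed k l).

Definition cocycle (k : nat) (l : R) := {phi : cochain k l | is_cocycle phi}.
HB.instance Definition _ k l := SubChoice.on (cocycle k l).
HB.instance Definition _ k l := [SubChoice_isSubZmodule of cocycle k l by <:].

Definition coboundaries k l : {pred cocycle k l} :=
  fun phi => `[< is_coboundary (val phi) >].

Fact coboundaries_zmod_closed k l : zmod_closed (@coboundaries k l).
Proof.
case: k => [|k]; split=> [|f g]; rewrite !unfold_in /=.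
- exact/asboolP.
- by move=> /asboolP f0 /asboolP g0; apply/asboolP; rewrite f0 g0 subrr.
- by apply/asboolP; exists 0; rewrite raddf0.
- move=> /asboolP[p pE] /asboolP[q qE]; apply/asboolP; exists (p - q).
  by rewrite raddfB pE qE.
Qed.
HB.instance Definition _ k l :=
  GRing.isZmodClosed.Build (cocycle k l) (@coboundaries k l)
    (@coboundaries_zmod_closed k l).

Definition MH (k : nat) (l : R) := Quotient.quot (@coboundaries k l).
HB.instance Definition _ k l := ZmodQuotient.on (MH k l).

Fact cup_is_cocycle k1 l1 k2 l2 (phi : cocycle k1 l1) (psi : cocycle k2 l2) :
  is_cocycle (cup (val phi) (val psi)).
Proof.
rewrite /is_cocycle /=; apply/eqP/hom_malgP => s; rewrite cobound_cup.
have /eqP -> := valP phi; have /eqP -> := valP psi.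
by rewrite !hom0E mul0r mulr0 mul0r addr0.
Qed.

Definition cocycle_cup k1 l1 k2 l2 (phi : cocycle k1 l1) (psi : cocycle k2 l2) :
    cocycle (k1 + k2)%N (l1 + l2) :=
  exist _ (cup (val phi) (val psi)) (cup_is_cocycle phi psi).

(* Independence of the representatives is MH_mul_pi below. *)
Definition MH_mul k1 l1 k2 l2 (x : MH k1 l1) (y : MH k2 l2) :
    MH (k1 + k2)%N (l1 + l2) :=
  \pi_(MH (k1 + k2)%N (l1 + l2)) (cocycle_cup (repr x) (repr y)).

Lemma cocycle_cupDl k1 l1 k2 l2 (p q : cocycle k1 l1) (r : cocycle k2 l2) :
  cocycle_cup (p - q) r = cocycle_cup p r - cocycle_cup q r.
Proof.
apply/val_inj/hom_malgP => s; rewrite [in RHS]raddfB [RHS]homDE homNE /cup.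
rewrite !fgextU /cup_fun [val (p - q)]raddfB homDE homNE.
by rewrite mulrBl.
Qed.

Lemma cocycle_cupDr k1 l1 k2 l2 (r : cocycle k1 l1) (p q : cocycle k2 l2) :
  cocycle_cup r (p - q) = cocycle_cup r p - cocycle_cup r q.
Proof.
apply/val_inj/hom_malgP => s; rewrite [in RHS]raddfB [RHS]homDE homNE /cup.
rewrite !fgextU /cup_fun [val (p - q)]raddfB homDE homNE.
by rewrite mulrBr.
Qed.

Lemma is_coboundary_eq k k' l (phi : cochain k l) (psi : cochain k' l) :
  k = k'.+1 ->
  (forall s : simplex k'.+1 l,
    phi (simplex_chain k l (val s)) = cobound psi << s >>) ->
  is_coboundary phi.
Proof.
move=> e; case: _ / (esym e) phi => phi {e} E; exists psi.
by apply: hom_malgP => s; rewrite -E simplex_chainK.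
Qed.

Lemma is_coboundary0 k l : is_coboundary (0 : cochain k l).
Proof. by case: k => // k; exists 0; rewrite raddf0. Qed.

Lemma cup_coboundaryl k1 l1 k2 l2 (p : cocycle k1 l1) (q : cocycle k2 l2) :
  is_coboundary (val p) -> is_coboundary (cup (val p) (val q)).
Proof.
case: k1 p => [|k1] p.
  move=> /= p0; rewrite (_ : cup _ _ = 0); first exact: is_coboundary0.
  by apply: hom_malgP => s; rewrite fgextU /cup_fun p0 !hom0E mul0r.
case=> psi pE; apply: (@is_coboundary_eq _ _ _ _ (cup psi (val q))) => // s.
rewrite cobound_cup (eqP (valP q)) hom0E mulr0 mul0r addr0.
by rewrite cupE pE.
Qed.

Lemma cup_coboundaryr k1 l1 k2 l2 (p : cocycle k1 l1) (q : cocycle k2 l2) :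
  is_coboundary (val q) -> is_coboundary (cup (val p) (val q)).
Proof.
case: k2 q => [|k2] q.
  move=> /= q0; rewrite (_ : cup _ _ = 0); first exact: is_coboundary0.
  by apply: hom_malgP => s; rewrite fgextU /cup_fun q0 !hom0E mulr0.
case=> psi qE.
apply: (@is_coboundary_eq _ _ _ _ (cup (val p) psi *~ (-1) ^+ k1)) => [|s].
  by rewrite addnS.
rewrite raddfMz /= homMzE cobound_cup (eqP (valP p)) hom0E mul0r add0r.
by rewrite cupE qE mulrzz -[RHS]mulrA -exprMn mulrN1 opprK expr1n mulr1.
Qed.

Lemma MH_mul_pi k1 l1 k2 l2 (p : cocycle k1 l1) (q : cocycle k2 l2) :
  MH_mul (\pi_(MH k1 l1) p) (\pi_(MH k2 l2) q) =
  \pi_(MH (k1 + k2)%N (l1 + l2)) (cocycle_cup p q).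
Proof.
rewrite /MH_mul; apply/eqP; rewrite -Quotient.idealrBE.
set p' := repr _; set q' := repr _.
have -> : cocycle_cup p' q' - cocycle_cup p q
    = cocycle_cup (p' - p) q' + cocycle_cup p (q' - q).
  by rewrite cocycle_cupDl cocycle_cupDr addrA subrK.
have pB : p' - p \in @coboundaries k1 l1 by rewrite Quotient.idealrBE reprK.
have qB : q' - q \in @coboundaries k2 l2 by rewrite Quotient.idealrBE reprK.
apply: rpredD; apply/asboolP.
  by apply: cup_coboundaryl; apply/asboolP.
by apply: cup_coboundaryr; apply/asboolP.
Qed.

End MagnitudeCohomology.

Section Presentation.
Variables (R : realType) (G : choiceType) (degk : G -> nat) (degl : G -> R).

(* The free associative unital ring on G. The free nonunital ring on G is the
   subset of the elements without constant term. *)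
Local Notation A := {malg {fmonom G}}.

Definition nonunital : {pred A} := [pred f : A | f@_(mone : {fmonom G}) == 0].

Variable rels : A -> Prop.

(* The two-sided ideal of the nonunital ring generated by rels. *)
Inductive ideal : A -> Prop :=
| ideal_rel f of rels f : ideal f
| ideal0 : ideal 0
| idealB f g of ideal f & ideal g : ideal (f - g)
| idealMl f g of f \in nonunital & ideal g : ideal (f * g)
| idealMr f g of ideal f & g \in nonunital : ideal (f * g).

Definition word_degk (w : {fmonom G}) : nat := (\sum_(g <- (w : seq G)) degk g)%N.
Definition word_degl (w : {fmonom G}) : R := \sum_(g <- (w : seq G)) degl g.

(* The span of the nonempty words of bidegree (k, l). *)
Definition homog (k : nat) (l : R) : {pred A} :=
  [pred f : A | all (fun w : {fmonom G} =>
    [&& w != mone, word_degk w == k & word_degl w == l]) (msupp f)].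

Fact homog_zmod_closed k l : zmod_closed (homog k l).
Proof.
split=> [|f g]; rewrite !inE ?msupp0 // => /allP fP /allP gP.
apply/allP => w /(fsubsetP (msuppB_le f g)).
by rewrite in_fsetU => /orP[/fP | /gP].
Qed.
HB.instance Definition _ k l :=
  GRing.isZmodClosed.Build A (homog k l) (homog_zmod_closed k l).

Lemma homogM k1 l1 k2 l2 f g : f \in homog k1 l1 -> g \in homog k2 l2 ->
  f * g \in homog (k1 + k2)%N (l1 + l2).
Proof.
rewrite !inE => /allP fP /allP gP; apply/allP => w /msuppM_le[u [v [uf vg ->]]].
have /and3P[u1 /eqP uk /eqP ul] := fP _ uf.
have /and3P[v1 /eqP vk /eqP vl] := gP _ vg.
apply/and3P; split.
- by apply: contra u1 => /unitmP[].
- by rewrite /word_degk fmM big_cat /= -uk -vk.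
- by rewrite /word_degl fmM big_cat /= -ul -vl.
Qed.

Lemma homog_nonunital k l f : f \in homog k l -> f \in nonunital.
Proof.
rewrite !inE => /allP fP; rewrite mcoeff_eq0.
by apply/negP => /fP; rewrite eqxx.
Qed.

Definition free_part (k : nat) (l : R) := {f : A | homog k l f}.
HB.instance Definition _ k l := SubChoice.on (free_part k l).
HB.instance Definition _ k l := [SubChoice_isSubZmodule of free_part k l by <:].

Definition ideal_part k l : {pred free_part k l} := fun f => `[< ideal (val f) >].

Fact ideal_part_zmod_closed k l : zmod_closed (@ideal_part k l).
Proof.
split=> [|f g]; first exact/asboolP/ideal0.
by move=> /asboolP fI /asboolP gI; apply/asboolP; rewrite raddfB; exact: idealB.
Qed.
HB.instance Definition _ k l :=
  GRing.isZmodClosed.Build (free_part k l) (@ideal_part k l)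
    (@ideal_part_zmod_closed k l).

(* The component of bidegree (k, l) of the free nonunital ring modulo the
   ideal. *)
Definition presented (k : nat) (l : R) := Quotient.quot (@ideal_part k l).
HB.instance Definition _ k l := ZmodQuotient.on (presented k l).

Definition free_mul k1 l1 k2 l2 (f : free_part k1 l1) (g : free_part k2 l2) :
    free_part (k1 + k2)%N (l1 + l2) :=
  exist _ (val f * val g) (homogM (valP f) (valP g)).

(* Independence of the representatives is presented_mul_pi below. *)
Definition presented_mul k1 l1 k2 l2
    (x : presented k1 l1) (y : presented k2 l2) :
    presented (k1 + k2)%N (l1 + l2) :=
  \pi_(presented (k1 + k2)%N (l1 + l2)) (free_mul (repr x) (repr y)).

Lemma presented_mul_pi k1 l1 k2 l2 (f : free_part k1 l1) (g : free_part k2 l2) :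
  presented_mul (\pi_(presented k1 l1) f) (\pi_(presented k2 l2) g) =
  \pi_(presented (k1 + k2)%N (l1 + l2)) (free_mul f g).
Proof.
rewrite /presented_mul; apply/eqP; rewrite -Quotient.idealrBE.
set f' := repr _; set g' := repr _.
have /asboolP fI : f' - f \in @ideal_part k1 l1 by rewrite Quotient.idealrBE reprK.
have /asboolP gI : g' - g \in @ideal_part k2 l2 by rewrite Quotient.idealrBE reprK.
apply/asboolP; move: fI gI; rewrite !raddfB /= => fI gI.
have -> : val f' * val g' - val f * val g
    = (val f' - val f) * val g' - (- val f) * (val g' - val g).
  by rewrite mulrBl mulNr opprK mulrBr addrA subrK.
have nu h : homog k1 l1 h -> h \in nonunital by exact: homog_nonunital.
apply: idealB; first by apply: idealMr (homog_nonunital (valP g')).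
apply: idealMl gI; apply: (@homog_nonunital k1 l1).
by rewrite rpredN; exact: (valP f).
Qed.

End Presentation.

Section CycleGraph.

(* The shortest-path distance, for a connected graph: on a connected graph a
   shortest path has fewer than #|T| edges. *)
Definition gdist (T : finType) (e : rel T) (x y : T) : nat :=
  \big[minn/#|T|]_(k < #|T| | [exists p : k.-tuple T, path e x p && (last x p == y)])
    (k : nat).

Variable n : nat.

(* For n >= 2 only, 'Z_n is Z/n. *)
Definition cycle_adj : rel 'Z_n := fun x y => (x - y == 1) || (x - y == -1).

Definition cycle_dist (x y : 'Z_n) : nat := gdist cycle_adj x y.

Definition cycle_metric (R : realType) (x y : 'Z_n) : R := (cycle_dist x y)%:R.

Variable m : nat.

Definition oriented_edge := {p : 'Z_n * 'Z_n | cycle_adj p.1 p.2}.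
Definition far_pair := {p : 'Z_n * 'Z_n | cycle_dist p.1 p.2 == m}.

Definition gen := ('Z_n + oriented_edge + far_pair)%type.
HB.instance Definition _ := Choice.on gen.

Definition gen_degk (g : gen) : nat :=
  match g with inl (inl _) => 0 | inl (inr _) => 1 | inr _ => 2 end.

Definition gen_degl (R : realType) (g : gen) : R :=
  match g with inl (inl _) => 0 | inl (inr _) => 1 | inr _ => m.+1%:R end.

Local Notation A := {malg {fmonom gen}}.

Definition gen_e (x : 'Z_n) : A := << fmu (inl (inl x) : gen) >>.
Definition gen_a x y (xy : cycle_adj x y) : A :=
  << fmu (inl (inr (exist _ (x, y) xy)) : gen) >>.
Definition gen_b x z (xz : cycle_dist x z == m) : A :=
  << fmu (inr (exist _ (x, z) xz) : gen) >>.

Inductive cycle_rels : A -> Prop :=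
| rel_ee x :
    cycle_rels (gen_e x * gen_e x - gen_e x)
| rel_ee0 x y of x <> y :
    cycle_rels (gen_e x * gen_e y)
| rel_ea x y (xy : cycle_adj x y) :
    cycle_rels (gen_a xy - gen_e x * gen_a xy)
| rel_ae x y (xy : cycle_adj x y) :
    cycle_rels (gen_a xy - gen_a xy * gen_e y)
| rel_eb x z (xz : cycle_dist x z == m) :
    cycle_rels (gen_b xz - gen_e x * gen_b xz)
| rel_be x z (xz : cycle_dist x z == m) :
    cycle_rels (gen_b xz - gen_b xz * gen_e z)
| rel_aa x y z (xy : cycle_adj x y) (yz : cycle_adj y z) of x <> z :
    cycle_rels (gen_a xy * gen_a yz)
| rel_ab w x y z (eps : 'Z_n) of
    eps = 1 \/ eps = -1 & x = w + eps & y = x + eps *+ m & z = y + eps :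
    forall (wx : cycle_adj w x) (xz : cycle_dist x z == m)
           (wy : cycle_dist w y == m) (yz : cycle_adj y z),
    cycle_rels (gen_a wx * gen_b xz - gen_b wy * gen_a yz).

End CycleGraph.

(* Main.v *)
Require Import Defs.
From HB Require Import structures.
From mathcomp Require Import all_boot all_order all_algebra.
From mathcomp Require Import boolp reals.
From mathcomp Require Import xfinmap monalg.
From mathcomp Require Import zify ring.

Set Implicit Arguments.
Unset Strict Implicit.
Unset Printing Implicit Defensive.

Import GRing.Theory.
Local Open Scope ring_scope.

(** The idea is that magnitude cochains are the bar complex of a monomial algebra.
On an odd cycle there is exactly one geodesic between any two vertices, so a
simplex is a starting vertex followed by signed steps of size at most m, and
deleting an interior vertex adds two consecutive steps whenever they have the
same direction and their sum is at most m.  The obstructions to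
adding steps are a change of direction and a path of length m.+1 in one
direction; the cohomology is the Ext algebra of the corresponding monomial
algebra, and has a basis indexed by the chains of overlapping obstructions.

For this algebra such a chain of degree k is a vertex x with a word t of k
directions: every maximal run of equal directions is walked with steps of length
1, m, 1, m, ...  The resulting simplex [critical x t] has no geodesic interior
vertex ([critical_rigid]), so it is a cycle on its own, and evaluating cocycles
at the critical simplices is well defined on cohomology.

Evaluation is injective: a cocycle vanishing on all critical simplices is a
coboundary ([cocycle_exact]).  Looking at the first two steps of a simplex, the
part that starts like a critical simplex is a copy of the complex in lower degree
and is treated by induction; on the rest, cutting a unit step off the first
step is a contracting homotopy.

On the side of the presentation, a word in the generators defines a cocycle by
cup products ([word_cocycle]), and elements of the ideal vanish on simplices
without geodesic interior vertex ([ideal_rigid]).  Modulo the ideal every word is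
zero or one of the normal forms [normal_form x t] ([word_reduces]): a run of r
equal directions becomes b...b or b...b a according to the parity of r, because
a and b commute along a run and two a's in the same direction multiply to zero.
The normal forms are dual to the critical simplices ([normal_form_critical]).
Thus the normal forms span the presented ring, evaluation separates both sides,
and the multiplicative map from the presented ring to cohomology carries a basis
to a basis. *)

(** * Free abelian groups and monoid algebras *)

Section FreeAbelianInduction.
Variable S : choiceType.

Lemma malg_sumU (f : {malg S}) : f = \sum_(s <- msupp f) << s >> *~ f@_s.
Proof.
rewrite [LHS]monalgE; apply: eq_bigr => s _; apply/malgP => t.
rewrite raddfMz /= !mcoeffU.
by case: eqP => _; rewrite ?mulr0n ?mul0rz // !mulr1n intz.
Qed.

Lemma malg_ind (P : {malg S} -> Prop) :
  P 0 -> (forall s, P << s >>) -> (forall f g, P f -> P g -> P (f - g)) ->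
  forall f, P f.
Proof.
move=> P0 P1 PB f.
have PN g : P g -> P (- g) by move=> Pg; rewrite -sub0r; exact: PB.
have PD g h : P g -> P h -> P (g + h).
  by move=> Pg Ph; rewrite -[h]opprK; apply/PB/PN.
have PMn g i : P g -> P (g *+ i).
  by move=> Pg; elim: i => [|i IH]; rewrite ?mulr0n // mulrS; exact: PD.
rewrite (malg_sumU f); elim/big_ind: _ => // s _.
by case: (f@_s) => i; [exact: PMn | rewrite NegzE mulrNz; exact/PN/PMn].
Qed.

End FreeAbelianInduction.

Lemma malgUM (M : monomType) (u v : M) :
  << u >> * << v >> = << mmul u v >> :> {malg M}.
Proof. by rewrite malgM_def fgmulUU mulr1. Qed.

(** * The differential on functions of vertex sequences *)

Section Differential.
Variables (X : choiceType) (d : X -> X -> nat).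
Hypothesis d_eq0 : forall x y, (d x y == 0)%N = (x == y).
Hypothesis d_triangle : forall x y z, (d x z <= d x y + d y z)%N.
Local Notation neqr := (fun x y : X => x != y).
Implicit Types (s v : seq X) (phi psi : seq X -> int).

Definition between (x y z : X) : bool := d x z == (d x y + d y z)%N.

(** The differential with all degrees and lengths at once.  Recursion on the first
vertex replaces the signs (-1) ^+ i: an interior vertex moves one place when a
vertex is put in front, hence the minus sign before the recursive call. *)
Fixpoint codiff phi s : int :=
  match s with
  | x :: ((y :: z :: r) as s') =>
      - (if between x y z then phi (x :: z :: r) else 0)
      - codiff (fun v => phi (x :: v)) s'
  | _ => 0
  end.

Inductive face_of : seq X -> seq X -> Prop :=
| face_here x y z r of between x y z : face_of (x :: z :: r) (x :: y :: z :: r)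
| face_next x v s of face_of v s : face_of (x :: v) (x :: s).

Lemma codiff_cons phi x y z r : codiff phi [:: x, y, z & r] =
  - (if between x y z then phi (x :: z :: r) else 0)
  - codiff (fun v => phi (x :: v)) [:: y, z & r].
Proof. by []. Qed.

(** Only the faces of s matter.  Since faces keep the first vertex, the total length
and the direction of the first step, a function may be changed according to these
data without affecting its differential. *)
Lemma codiff_local phi psi s :
  (forall v, face_of v s -> phi v = psi v) -> codiff phi s = codiff psi s.
Proof.
elim: s phi psi => // x [|y [|z r]] // IH phi psi H.
rewrite !codiff_cons.
congr (- _ - _); first by case: ifP => // B; apply: H; constructor.
by apply: IH => v vf; apply: H; constructor.
Qed.

Lemma codiff0 s : codiff (fun=> 0) s = 0.
Proof.
by elim: s => // x [|y [|z r]] //= ->; case: ifP; rewrite oppr0 subr0.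
Qed.

Lemma codiff_eq0 phi s : (forall v, face_of v s -> phi v = 0) -> codiff phi s = 0.
Proof. by move=> H; rewrite -[RHS](codiff0 s); apply: codiff_local. Qed.

Lemma codiffZ c phi s : codiff (fun v => c * phi v) s = c * codiff phi s.
Proof.
elim: s phi => [|x [|y [|z r]] IH] phi; rewrite ?mulr0 //.
have /= -> := IH (fun v => phi (x :: v)).
by case: ifP => _; rewrite ?mulrBr ?mulrN ?mulr0.
Qed.

Lemma codiffD phi psi s : codiff (fun v => phi v + psi v) s = codiff phi s + codiff psi s.
Proof.
elim: s phi psi => [|x [|y [|z r]] IH] phi psi; rewrite ?addr0 //.
have /= -> := IH (fun v => phi (x :: v)) (fun v => psi (x :: v)).
by case: ifP => _; ring.
Qed.

Lemma face_head v y s : face_of v (y :: s) -> exists v', v = y :: v'.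
Proof.
by move E: (y :: s) => t F; case: F E => [x ? z r _|x v' ? _] [-> _];
  [exists (z :: r)|exists v'].
Qed.

Lemma face_consE v y s : face_of v (y :: s) ->
  (exists a b r, [/\ s = a :: b :: r, v = y :: b :: r & between y a b])
  \/ exists2 v', v = y :: v' & face_of v' s.
Proof.
move E: (y :: s) => t F; case: F E => [x a z r B|x v' s' F] [-> ->].
  by left; exists a, z, r.
by right; exists v'.
Qed.

Lemma between_neq x y z : x != y -> between x y z -> x != z.
Proof. by rewrite -!d_eq0 /between => xy /eqP ->; rewrite addn_eq0 negb_and xy. Qed.

Lemma face_size v s : face_of v s -> size s = (size v).+1.
Proof. by elim=> //= x v' s' _ ->. Qed.

Lemma face_sorted v s : face_of v s -> sorted neqr s -> sorted neqr v.
Proof.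
elim=> {v s} [x y z r B|x v s F IH] /=.
  by case/and3P => xy _ ->; rewrite (between_neq xy B).
case: s F IH => [|y s] F IH /=; first by inversion F.
by case/andP => xy /IH; have [v' ->] := face_head F => /= ->; rewrite xy.
Qed.

Fixpoint nat_length s : nat :=
  (if s is x :: s' then (if s' is y :: _ then d x y else 0) + nat_length s' else 0)%N.

Lemma face_length v s : face_of v s -> nat_length v = nat_length s.
Proof.
elim=> {v s} [x y z r /eqP B|x v s F IH] /=; first by rewrite B -addnA.
rewrite IH; case: s F {IH} => [|y s] F; first by inversion F.
by have [v' ->] := face_head F.
Qed.

Lemma length_split k s : (nat_length (take k.+1 s) + nat_length (drop k s))%N = nat_length s.
Proof.
elim: k s => [|k IH] [|x s] //; first by rewrite /= take0.
by rewrite /= -(IH s); case: s {IH} => [|y s] //=; rewrite -addnA.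
Qed.

(** Each side says that d x w is the sum of the three consecutive distances; by the
triangle inequality the inner pairs are then geodesic as well.  This is what
makes the differential square to zero. *)
Lemma between_assoc x y z w :
  between x y z && between x z w = between y z w && between x y w.
Proof.
rewrite /between.
have := d_triangle x y w; have := d_triangle y z w; have := d_triangle x z w.
by have := d_triangle x y z; lia.
Qed.

Lemma codiff_codiff phi s : codiff (codiff phi) s = 0.
Proof.
elim: s phi => [|x [|y [|z r]] IH] phi //; rewrite codiff_cons.
(* G collects the terms in which the first interior vertex is deleted by the
   inner differential. *)
pose G v := - (if v is y' :: z' :: r' then
  (if between x y' z' then phi [:: x, z' & r'] else 0) else 0).
have -> : codiff (fun v => codiff phi (x :: v)) [:: y, z & r] =
          codiff (fun v => G v + -1 * codiff (fun u => phi (x :: u)) v) [:: y, z & r].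
  by apply: codiff_local => v /face_head[[|z' v'] ->]; rewrite /G mulN1r //= oppr0 subr0.
rewrite codiffD codiffZ IH mulr0 addr0.
case: r IH => [|w r] IH; first by case: ifP; rewrite /= ?oppr0 ?subr0.
rewrite !codiff_cons; set c := codiff _ [:: z, w & r].
have -> : codiff (fun v => G (y :: v)) [:: z, w & r] =
  - (if between x y z then c else 0).
  have -> : (if between x y z then c else 0) = (between x y z)%:R * c.
    by case: ifP; rewrite ?mul1r ?mul0r.
  rewrite -mulNr -codiffZ; apply: codiff_local => v /face_head[v' ->].
  by rewrite /G; case: ifP => _; rewrite ?mulN1r // !mulNr mul0r.
have := between_assoc x y z w; rewrite /G.
by case: (between x y z); case: (between x z w); case: (between y z w);
  case: (between x y w) => //= _; rewrite ?oppr0 ?subr0 ?opprK ?add0r ?addr0; ring.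
Qed.

(** A rigid simplex has zero boundary. *)
Fixpoint rigid s : bool :=
  if s is x :: ((y :: z :: _) as s') then ~~ between x y z && rigid s' else true.

Lemma codiff_rigid phi s : rigid s -> codiff phi s = 0.
Proof.
elim: s phi => // x [|y [|z r]] // IH phi.
rewrite codiff_cons => /andP[/negPf -> /IH ->].
by rewrite oppr0 subr0.
Qed.

Lemma rigid_behead x s : rigid (x :: s) -> rigid s.
Proof. by case: s => // y [|z r] //= /andP[]. Qed.

Lemma rigid_drop i s : rigid s -> rigid (drop i s).
Proof. by elim: s i => // x s IH [|i] //= /rigid_behead/IH. Qed.

Lemma rigid_take i s : rigid s -> rigid (take i s).
Proof.
elim: s i => // x [|y [|z r]] IH [|[|[|i]]] //=.
by case/andP=> -> /(IH i.+2).
Qed.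
Section Typed.
Variable R : realType.
Local Notation D := (fun x y : X => (d x y)%:R : R).
Local Notation chain_at k l := (simplex_chain D k l).

Lemma path_lengthE s : path_length D s = (nat_length s)%:R.
Proof.
elim: s => [|x [|y s] IH]; rewrite /path_length ?big_nil //=.
by rewrite big_cons /= -[\sum_(_ <- _) _]/(path_length D (y :: s)) IH natrD.
Qed.

Lemma is_simplexE k l s :
  is_simplex D k l s = [&& size s == k.+1, sorted neqr s & (nat_length s)%:R == l].
Proof. by rewrite /is_simplex path_lengthE. Qed.

Definition cochain_of k l phi : cochain D k l :=
  fgext (fun s : simplex D k l => phi (val s)).

Lemma cochain_ofE k l phi s :
  cochain_of k l phi (chain_at k l s) = if is_simplex D k l s then phi s else 0.
Proof.
case: ifP => h; last by rewrite simplex_chainN // raddf0.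
by rewrite -[s]/(val (exist (is_simplex D k l) s h)) simplex_chainK fgextU.
Qed.

Lemma cochain_of_eval k l (phi : cochain D k l) :
  cochain_of k l (fun s => phi (chain_at k l s)) = phi.
Proof. by apply: hom_malgP => s; rewrite fgextU simplex_chainK. Qed.

Lemma geodesic_at1 x y z r :
  geodesic_at D 1 [:: x, y, z & r] = between x y z.
Proof. by rewrite /geodesic_at /= -natrD Num.Theory.eqr_nat. Qed.

Lemma codiff_sum phi s :
  \sum_(1 <= i < (size s).-1)
    (if geodesic_at D i s then phi (face i s) else 0) *~ (-1) ^+ i = codiff phi s.
Proof.
elim: s phi => [|x [|y [|z r]] IH] phi; try by rewrite big_geq.
rewrite codiff_cons -IH big_ltn // big_add1 /= geodesic_at1 /face /=.
congr (_ + _); rewrite -sumrN; apply: eq_big_nat => -[|i] // _.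
by rewrite exprS mulN1r mulrNz.
Qed.

(** A cochain of given degree and length is recovered from the function of vertex
sequences that is zero outside these, so cocycles can be handled untyped. *)
Lemma cobound_codiff k l (phi : cochain D k l) s :
  sorted neqr s -> size s = k.+2 ->
  cobound phi (chain_at k.+1 l s) = codiff (fun v => phi (chain_at k l v)) s.
Proof. by move=> so sz; rewrite coboundE // -codiff_sum sz. Qed.

Lemma face_simplex k l v s : face_of v s ->
  is_simplex D k.+1 l s -> is_simplex D k l v.
Proof.
move=> F; rewrite !is_simplexE => /and3P[/eqP sz so lE].
move: sz; rewrite (face_size F) => -[->]; rewrite eqxx (face_sorted F so).
by rewrite (face_length F).
Qed.

Lemma cobound_cochain_of k l phi (s : simplex D k.+1 l) :
  cobound (cochain_of k l phi) << s >> = codiff phi (val s).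
Proof.
have sS := valP s; have := sS; rewrite is_simplexE => /and3P[/eqP sz so _].
rewrite -simplex_chainK cobound_codiff //; apply: codiff_local => v F.
by rewrite cochain_ofE (face_simplex F sS).
Qed.

Lemma is_coboundary_of k l phi psi :
  (forall s, sorted neqr s -> size s = k.+1 -> phi s = codiff psi s) ->
  is_coboundary (cochain_of k l phi).
Proof.
move=> H; have {}H s : is_simplex D k l s -> phi s = codiff psi s.
  by rewrite is_simplexE => /and3P[/eqP sz so _]; apply: H.
case: k H => [|k] H /=.
  apply: hom_malgP => s; rewrite fgextU H ?hom0E; last exact: valP.
  by have := valP s; rewrite is_simplexE; case: (val s) => [|x []].
by exists (cochain_of k l psi); apply: hom_malgP => s;
  rewrite fgextU cobound_cochain_of H //; exact: valP.
Qed.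

Lemma coboundary_rigid k l (phi : cochain D k l) s :
  is_coboundary phi -> rigid s -> phi (chain_at k l s) = 0.
Proof.
case: k phi => [|k] phi /=; first by move=> ->.
case=> psi -> rs; case E : (is_simplex D k.+1 l s); last first.
  by rewrite simplex_chainN // raddf0.
move: E; rewrite is_simplexE => /and3P[/eqP sz so _].
by rewrite cobound_codiff // codiff_rigid.
Qed.

End Typed.
End Differential.

(** * Words of directions *)

(** A run of equal directions is consumed two letters at a time: a doubled letter
stands for a generator of degree 2, and a single letter in front of a turn or of
the end for a generator of degree 1. *)
Lemma signs_ind (P : seq bool -> Prop) :
  P [::] -> (forall e t, ohead t != Some e -> P t -> P (e :: t)) ->
  (forall e t, P t -> P [:: e, e & t]) -> forall t, P t.
Proof.
move=> P0 Pturn Pstraight t.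
have [k] := ubnP (size t); elim: k t => // k IH [|e t] //= tk.
case E: (ohead t == Some e); last by apply: Pturn; [rewrite E | exact: IH].
case: t E tk => // e' t /eqP[->] /= tk; apply/Pstraight/IH.
lia.
Qed.

(** * Distances and directions on an odd cycle *)

Lemma geq_bigminn (I : eqType) (r : seq I) (P : pred I) (F : I -> nat) a i :
  i \in r -> P i -> (\big[minn/a]_(j <- r | P j) F j <= F i)%N.
Proof.
elim: r => // j r IH; rewrite inE big_cons => /orP[/eqP <- -> | ir Pi].
  by rewrite geq_minl.
by case: ifP => _; [apply: leq_trans (geq_minr _ _) _|]; exact: IH.
Qed.

Section OddCycle.
Variables (m n : nat).
Hypotheses (hm : (2 <= m)%N) (hn : n = (2 * m + 1)%N).
Local Notation X := 'Z_n.
Local Notation d := (@cycle_dist n).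
Local Notation btw := (between d).
Local Notation neqr := (fun x y : X => x != y).

(** The number of steps from x to y in the direction of + 1.  Stated with [cw], every
fact on distances and directions is linear arithmetic. *)
Definition cw (x y : X) : nat := val (y - x)%R.

Lemma Zp_cast_odd : (Zp_trunc n).+2 = n.
Proof. by apply: Zp_cast; lia. Qed.

Lemma cw_lt x y : (cw x y < n)%N.
Proof. by rewrite -[X in (_ < X)%N]Zp_cast_odd /cw ltn_ord. Qed.

Lemma cw_eq0 x y : (cw x y == 0)%N = (x == y).
Proof. by rewrite [RHS]eq_sym -subr_eq0 -val_eqE. Qed.

Lemma cw_inj x y z : cw x y = cw x z -> y = z.
Proof. by rewrite /cw => /val_inj/addIr. Qed.

Lemma cw_xx x : cw x x = 0%N.
Proof. by apply/eqP; rewrite cw_eq0. Qed.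

Lemma cw_add x y z :
  cw x z = (cw x y + cw y z)%N \/ (cw x z + n)%N = (cw x y + cw y z)%N.
Proof.
have -> : cw x z = ((cw x y + cw y z) %% n)%N.
  by rewrite /cw -{1}(subrK y z) -addrA addrC -[X in (_ %% X)%N]Zp_cast_odd.
have := cw_lt x y; have := cw_lt y z; case: (ltnP (cw x y + cw y z) n) => h h1 h2.
  by left; rewrite modn_small.
right; rewrite -{1}(subnK h) modnDr modn_small; lia.
Qed.

Definition unit_step (e : bool) : X := if e then 1 else -1.

Lemma cw_unit_step x e j : (0 < j < n)%N ->
  cw x (x + unit_step e *+ j) = if e then j else (n - j)%N.
Proof.
move=> jn; have h1 : cw x (x + unit_step true *+ j) = j.
  rewrite /cw addrAC subrr add0r /unit_step Zp_nat /= -[RHS](@modn_small j n); last by lia.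
  by rewrite -[X in _ = (_ %% X)%N]Zp_cast_odd.
case: e => //; have := cw_add (x + unit_step false *+ j) x (x + unit_step false *+ j).
rewrite cw_xx; have -> : cw (x + unit_step false *+ j) x = j.
  rewrite -[RHS]h1 /cw; congr val; rewrite opprD addrA subrr add0r addrAC subrr.
  by rewrite add0r /unit_step mulNrn opprK.
by have := cw_lt x (x + unit_step false *+ j); lia.
Qed.

Lemma cycle_adj_cw x y : cycle_adj x y = (cw x y == 1)%N || (cw x y == n.-1)%N.
Proof.
have E e : (y == x + unit_step e *+ 1) = (cw x y == if e then 1 else n.-1)%N.
  apply/eqP/eqP => [->|h]; first by rewrite cw_unit_step; case: e; lia.
  by apply: (@cw_inj x); rewrite h cw_unit_step; case: (e); lia.
rewrite -(E true) -(E false) /cycle_adj /unit_step !mulr1n orbC; congr (_ || _).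
  by rewrite subr_eq [-1 + y]addrC [LHS]eq_sym subr_eq.
by rewrite subr_eq [RHS]eq_sym subr_eq addrC.
Qed.

Lemma walk_length (x : X) (p : seq X) : path (@cycle_adj n) x p ->
  (minn (cw x (last x p)) (n - cw x (last x p)) <= size p)%N.
Proof.
elim: p x => [|y p IH] x /=; first by rewrite cw_xx min0n.
move=> /andP[xy /IH]; move: xy; rewrite cycle_adj_cw.
have := cw_add x y (last y p); have := cw_lt x (last y p).
by have := cw_lt y (last y p); lia.
Qed.

Lemma straight_walk (x : X) e j :
  let p := mkseq (fun i => x + unit_step e *+ i.+1) j in
  path (@cycle_adj n) x p /\ last x p = x + unit_step e *+ j.
Proof.
elim: j => [|j [IH1 IH2]]; first by rewrite /= mulr0n addr0.
have -> : mkseq (fun i => x + unit_step e *+ i.+1) j.+1 =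
    rcons (mkseq (fun i => x + unit_step e *+ i.+1) j) (x + unit_step e *+ j.+1).
  by rewrite /mkseq -{1}(addn1 j) iotaD map_cat -cats1.
rewrite /= rcons_path last_rcons IH1 IH2 cycle_adj_cw; split=> //.
rewrite mulrSr addrA -[X in cw _ (_ + X)]mulr1n cw_unit_step; last by lia.
by case: e {IH1 IH2} => //; lia.
Qed.

Lemma cw_walk x y : x != y ->
  y = x + unit_step true *+ cw x y /\ y = x + unit_step false *+ (n - cw x y).
Proof.
rewrite -cw_eq0 => xy; have h := cw_lt x y.
by split; apply: (@cw_inj x); rewrite cw_unit_step; lia.
Qed.

(** Walking straight in either direction gives the upper bound; [walk_length] is the
lower bound for arbitrary walks. *)
Lemma distE x y : d x y = minn (cw x y) (n - cw x y).
Proof.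
have card : #|X| = n by rewrite card_ord Zp_cast_odd.
have up e j : (j < n)%N -> y = x + unit_step e *+ j -> (d x y <= j)%N.
  move=> jn yE; rewrite /cycle_dist /gdist.
  have jn' : (j < #|X|)%N by rewrite card.
  apply: (@geq_bigminn _ _ _ (fun k : 'I_#|X| => val k) _ (Ordinal jn')).
    exact: mem_index_enum.
  apply/existsP.
  have [w1 w2] := straight_walk x e j.
  have sz : size (mkseq (fun i => x + unit_step e *+ i.+1) j) == j by rewrite size_mkseq.
  by exists (Tuple sz); rewrite w1 w2 yE eqxx.
apply/eqP; rewrite eqn_leq; apply/andP; split; last first.
  rewrite /cycle_dist /gdist; elim/big_ind: _ => //.
  - by rewrite card; lia.
  - by move=> a b; lia.
  - move=> k /existsP[p /andP[pp /eqP pl]].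
    by have := walk_length pp; rewrite pl size_tuple.
have [xyE|xy] := eqVneq x y; last first.
  have [h1 h2] := cw_walk xy; have h := cw_lt x y; move: xy; rewrite -cw_eq0 => xy.
  by rewrite leq_min; apply/andP; split; [exact: up h1 | apply: up h2; lia].
apply: (@leq_trans 0%N) => //; apply: (up true); first by lia.
by rewrite mulr0n addr0.
Qed.

Definition dir (x y : X) : bool := (cw x y <= m)%N.
Definition step (x : X) (e : bool) : X := x + unit_step e.
(** Since n = m + m.+1, these m.+1 steps end at distance m, on the other side. *)
Definition jump (x : X) (e : bool) : X := x + unit_step e *+ m.+1.

Lemma cw_step x e : cw x (step x e) = if e then 1%N else (2 * m)%N.
Proof. by rewrite /step -{1}[unit_step e]mulr1n cw_unit_step; case: e; lia. Qed.

Lemma cw_jump x e : cw x (jump x e) = if e then m.+1 else m.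
Proof. by rewrite /jump cw_unit_step; case: e; lia. Qed.

Lemma dist_eq0 x y : (d x y == 0)%N = (x == y).
Proof. by rewrite -cw_eq0 distE; have := cw_lt x y; lia. Qed.

Lemma dist_xx x : d x x = 0%N.
Proof. by apply/eqP; rewrite dist_eq0. Qed.

Lemma dist_gt0 x y : (0 < d x y)%N = (x != y).
Proof. by rewrite lt0n dist_eq0. Qed.

Lemma dist_le x y : (d x y <= m)%N.
Proof. by rewrite distE; have := cw_lt x y; lia. Qed.

Lemma dist_triangle x y z : (d x z <= d x y + d y z)%N.
Proof.
rewrite !distE; have := cw_add x y z; have := cw_lt x y; have := cw_lt y z.
by have := cw_lt x z; lia.
Qed.

Lemma betweenE x y z : x != y -> y != z ->
  btw x y z = (dir x y == dir y z) && (d x y + d y z <= m)%N.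
Proof.
rewrite -!cw_eq0 /between /dir !distE => xy yz.
have := cw_add x y z; have := cw_lt x y; have := cw_lt y z; have := cw_lt x z.
by move: (cw x y) (cw y z) (cw x z) xy yz => a b c; lia.
Qed.

Lemma between_dir x y z : x != y -> y != z -> btw x y z -> dir x z = dir x y.
Proof.
move=> xy yz; rewrite betweenE // /dir !distE; move: xy yz; rewrite -!cw_eq0.
have := cw_add x y z; have := cw_lt x y; have := cw_lt y z; have := cw_lt x z.
by move: (cw x y) (cw y z) (cw x z) => a b c; lia.
Qed.

Lemma adjE x y : cycle_adj x y = (d x y == 1)%N.
Proof. by rewrite cycle_adj_cw distE; have := cw_lt x y; lia. Qed.

Lemma dist_step x e : d x (step x e) = 1%N.
Proof. by rewrite distE cw_step; case: e; lia. Qed.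

Lemma dir_step x e : dir x (step x e) = e.
Proof. by rewrite /dir cw_step; case: e; lia. Qed.

Lemma dist_jump x e : d x (jump x e) = m.
Proof. by rewrite distE cw_jump; case: e; lia. Qed.

Lemma stepP x y : d x y = 1%N -> y = step x (dir x y).
Proof.
move=> h; apply: (@cw_inj x); rewrite cw_step; move: h; rewrite /dir distE.
by have := cw_lt x y; case: (leqP (cw x y) m); lia.
Qed.

Lemma jumpP x y : d x y = m -> y = jump x (~~ dir x y).
Proof.
move=> h; apply: (@cw_inj x); rewrite cw_jump; move: h; rewrite /dir distE.
by have := cw_lt x y; case: (leqP (cw x y) m) => /=; lia.
Qed.

Lemma jump_step x y e : y != step x e ->
  (y == jump x e) = (dir (step x e) y == e) && (d (step x e) y == m).
Proof.
move=> ne; have ne' : cw (step x e) y != 0%N by rewrite cw_eq0 eq_sym.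
have -> : (y == jump x e) = (cw x y == cw x (jump x e)).
  by apply/eqP/eqP => [->|/cw_inj].
rewrite cw_jump /dir distE; have := cw_add x (step x e) y; rewrite cw_step.
have := cw_lt x y; have := cw_lt (step x e) y.
by case: e ne ne' => ne ne'; rewrite ?eqb_id ?eqbF_neg; lia.
Qed.

Lemma step_jump x e : step (jump x e) e = jump (step x e) e.
Proof. by rewrite /step /jump addrAC. Qed.

(** A walk of m.+1 steps that changes direction has displacement of absolute value
less than m.+1 and of the same parity as m.+1.  In this range only m and - m are
congruent mod n to - m.+1 and m.+1, and they have the other parity. *)
Lemma detour_dir x y z e : z = jump x e ->
  (d x y + d y z)%N = m.+1 -> dir x y = e /\ dir y z = e.
Proof.
move=> zE; have := cw_jump x e; rewrite -zE => cz.
have := cw_add x y z; have := cw_lt x y; have := cw_lt y z.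
rewrite /dir !distE cz; case: e cz zE => _ _; lia.
Qed.

(** Both sides describe a path of three steps in one direction with total length
m.+1.  This is the cocycle condition for the generators of degree 2. *)
Lemma detour_coherent p q r u : p != q -> q != r -> r != u -> d p u = m ->
  btw p q r && (d p r + d r u == m.+1)%N = btw q r u && (d p q + d q u == m.+1)%N.
Proof.
move=> pq qr ru /jumpP uE; have pq0 := pq; have ru0 := ru.
rewrite -dist_gt0 in pq0; rewrite -dist_gt0 in ru0.
apply/andP/andP => -[B /eqP s]; have [d1 d2] := detour_dir uE s.
  have d3 := between_dir pq qr B; move: (B); rewrite betweenE // => /andP[/eqP d4 _].
  move/eqP: B => dE; have B' : btw q r u by rewrite betweenE // -d4 -d3 d1 d2 eqxx; lia.
  by split=> //; rewrite (eqP B'); lia.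
have d3 := between_dir qr ru B; move: (B); rewrite betweenE // => /andP[/eqP d4 _].
move/eqP: B => dE; have B' : btw p q r by rewrite betweenE // -d3 d1 d2 eqxx; lia.
by split=> //; rewrite (eqP B'); lia.
Qed.

Lemma between_step x y : (1 < d x y)%N -> btw x (step x (dir x y)) y.
Proof.
rewrite /between dist_step !distE; have := cw_step x (dir x y).
have := cw_add x (step x (dir x y)) y; have := cw_lt x y.
have := cw_lt (step x (dir x y)) y; rewrite /dir.
by case: (leqP (cw x y) m); lia.
Qed.

(** * Critical simplices *)

Fixpoint dirs (s : seq X) : seq bool :=
  if s is x :: s' then if s' is y :: _ then dir x y :: dirs s' else [::] else [::].

(** Runs of direction e are walked with steps of length 1, m, 1, m, ... : the vertex
after x and [step x e] is [jump x e], m further on. *)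
Fixpoint critical (x : X) (t : seq bool) : seq X :=
  if t is e :: t' then
    x :: (if t' is e' :: r then
            if e == e' then step x e :: critical (jump x e) r else critical (step x e) t'
          else [:: step x e])
  else [:: x].

Lemma critical_turn x e t : ohead t != Some e ->
  critical x (e :: t) = x :: critical (step x e) t.
Proof.
by case: t => [|e' t] //= h; case: eqP => // E; rewrite E eqxx in h.
Qed.

Lemma critical_straight x e t :
  critical x [:: e, e & t] = [:: x, step x e & critical (jump x e) t].
Proof. by rewrite /= eqxx. Qed.

Lemma critical_head x e t : exists r, critical x (e :: t) = [:: x, step x e & r].
Proof.
case: t => [|e' t] /=; first by exists [::].
case: eqP => _; first by exists (critical (jump x e) t).
by eexists.
Qed.

Lemma dist_step_jump x e : d (step x e) (jump x e) = m.
Proof.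
have ne : jump x e != step x e.
  by apply/eqP => /(congr1 (cw x)); rewrite cw_jump cw_step; case: (e); lia.
by have := eqxx (jump x e); rewrite {1}jump_step // => /andP[_ /eqP].
Qed.

Lemma dir_step_jump x e : dir (step x e) (jump x e) = e.
Proof.
have ne : jump x e != step x e.
  by apply/eqP => /(congr1 (cw x)); rewrite cw_jump cw_step; case: (e); lia.
by have := eqxx (jump x e); rewrite {1}jump_step // => /andP[/eqP].
Qed.

Lemma step_neq x e : x != step x e.
Proof. by rewrite -dist_gt0 dist_step. Qed.

Lemma step_jump_neq x e : step x e != jump x e.
Proof. by rewrite -dist_gt0 dist_step_jump; lia. Qed.

Lemma critical_cons x t : exists r, critical x t = x :: r.
Proof. by case: t => [|e t]; [exists [::] | have [r ->] := critical_head x e t; eexists]. Qed.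

Lemma size_critical x t : size (critical x t) = (size t).+1.
Proof.
elim/signs_ind: t x => [|e t h IH|e t IH] x //.
  by rewrite critical_turn //= IH.
by rewrite critical_straight /= IH.
Qed.

Lemma critical_sorted x t : sorted neqr (critical x t).
Proof.
elim/signs_ind: t x => [|e t h IH|e t IH] x //.
  rewrite critical_turn //; have := IH (step x e); have [r ->] := critical_cons (step x e) t.
  by rewrite /= step_neq.
rewrite critical_straight; have := IH (jump x e); have [r ->] := critical_cons (jump x e) t.
by rewrite /= step_neq step_jump_neq.
Qed.

Lemma not_between_long x y z : x != y -> y != z -> (m < d x y + d y z)%N ->
  btw x y z = false.
Proof. by move=> xy yz h; rewrite betweenE // [(_ <= m)%N]leqNgt h andbF. Qed.

(** Consecutive steps change direction or have total length m.+1. *)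
Lemma critical_rigid x t : rigid d (critical x t).
Proof.
elim/signs_ind: t x => [|e t h IH|e t IH] x //.
  rewrite critical_turn //; have := IH (step x e).
  case: t h {IH} => [|e' t] h //; have [r ->] := critical_head (step x e) e' t.
  move=> rr; apply/andP; split=> //; rewrite betweenE ?step_neq // !dir_step.
  by apply: contra h => /andP[/eqP -> _].
rewrite critical_straight; have := IH (jump x e).
have xs := step_neq x e; have sj := step_jump_neq x e.
have n1 : btw x (step x e) (jump x e) = false.
  by rewrite not_between_long // dist_step dist_step_jump; lia.
case: t {IH} => [|e' t]; first by rewrite /= n1.
have [r ->] := critical_head (jump x e) e' t; move=> rr.
apply/andP; split; first by rewrite n1.
apply/andP; split=> //; rewrite not_between_long ?step_neq //.
by rewrite dist_step_jump dist_step; lia.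
Qed.

Lemma dirs_critical x t : dirs (critical x t) = t.
Proof.
elim/signs_ind: t x => [|e t h IH|e t IH] x //.
  rewrite critical_turn //; have := IH (step x e); have [r ->] := critical_cons (step x e) t.
  by rewrite /= => ->; rewrite dir_step.
rewrite critical_straight; have := IH (jump x e); have [r ->] := critical_cons (jump x e) t.
by rewrite /= => ->; rewrite dir_step dir_step_jump.
Qed.

(** * Cocycles vanishing on critical simplices are coboundaries *)

Lemma codiff_head phi psi y s :
  (forall v, phi (y :: v) = psi (y :: v)) -> codiff d phi (y :: s) = codiff d psi (y :: s).
Proof. by move=> H; apply: codiff_local => v /face_head[v' ->]. Qed.

Lemma codiff_dir phi psi y z s : sorted neqr [:: y, z & s] ->
  (forall z' v, dir y z' = dir y z -> phi [:: y, z' & v] = psi [:: y, z' & v]) ->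
  codiff d phi [:: y, z & s] = codiff d psi [:: y, z & s].
Proof.
move=> so H; apply: codiff_local => v /face_consE[[a [b [r [[aE sE] -> B]]]]|[v' ->]].
  move: so B; rewrite -aE sE /= => /and3P[yz zb _] B; apply: H.
  exact: between_dir B.
by case/face_head => v'' ->; apply: H.
Qed.

Section CocycleExact.
Variables (k : nat) (phi : seq X -> int).
Hypothesis phi_cocycle :
  forall s, sorted neqr s -> size s = k.+2 -> codiff d phi s = 0.
Hypothesis phi_critical : forall x t, size t = k -> phi (critical x t) = 0.

(** When d x y is 1, the simplices starting with x, y whose vertex y is not geodesic
are those that turn at y ([turns_after]) and those that continue with a step of
length m ([runs_after]): these begin like critical simplices. *)
Definition turns_after x v : bool :=
  if v is y :: z :: _ then (d x y == 1)%N && (dir x y != dir y z) else false.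

Definition runs_after x y v : bool :=
  if v is z :: _ then [&& d x y == 1%N, dir x y == dir y z & d y z == m] else false.

(** The vertex y after x is not geodesic and deleting later vertices changes neither y
nor the direction of the step after y.  So the simplices that turn at y form a
copy of the complex of simplices starting at y, one degree lower. *)
Lemma turns_after_cocycle x s : (0 < k)%N -> sorted neqr s -> size s = k.+1 ->
  codiff d (fun v => if turns_after x v then phi (x :: v) else 0) s = 0.
Proof.
case: s => [|y [|z r]] // k0 so sz; case: (boolP (turns_after x [:: y, z & r])) => T.
  have /andP[/eqP xy1 dn] := T.
  have xy : x != y by rewrite -dist_gt0 xy1.
  have yz : y != z by case/andP: so.
  have so' : sorted neqr [:: x, y, z & r] by rewrite /= xy.
  have sz' : size [:: x, y, z & r] = k.+2 by rewrite /= -sz.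
  have := phi_cocycle so' sz'; rewrite codiff_cons betweenE // (negPf dn) oppr0 sub0r.
  move=> h; rewrite (@codiff_dir _ (fun v => phi (x :: v))) //.
    by apply/eqP; rewrite -oppr_eq0 h.
  by move=> z' v zE; move: T; rewrite /turns_after zE => ->.
rewrite (@codiff_dir _ (fun=> 0)) ?codiff0 // => z' v zE.
by move: T; rewrite /turns_after zE => /negPf ->.
Qed.

Lemma turns_after_critical x y t : size t = k.-1 -> (0 < k)%N ->
  (if turns_after x (critical y t) then phi (x :: critical y t) else 0) = 0.
Proof.
case: t => [|e t] // sz k0; case: ifP => //; have [r rE] := critical_head y e t.
rewrite {1}rE /turns_after dir_step => /andP[/eqP xy1 dn]; have yE := stepP xy1.
rewrite yE -critical_turn; first by rewrite phi_critical // -(prednK k0) -sz.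
by apply: contra dn => /eqP[->].
Qed.

(** A step of length m cannot be prolonged, so no face deletes y or z: the simplices
with steps 1, m in front form a copy of the whole complex, two degrees lower. *)
Lemma runs_after_cocycle x y s : (1 < k)%N -> sorted neqr s -> size s = k ->
  codiff d (fun v => if runs_after x y v then phi [:: x, y & v] else 0) s = 0.
Proof.
case: s => [|z [|w r]] k1 so sz; [by []|by rewrite -sz in k1|].
case: (boolP (runs_after x y [:: z, w & r])) => T; last first.
  rewrite (@codiff_head _ (fun=> 0)) ?codiff0 // => v.
  by move: T; rewrite /runs_after => /negPf ->.
have /and3P[/eqP xy1 de /eqP yzm] := T.
have xy : x != y by rewrite -dist_gt0 xy1.
have yz : y != z by rewrite -dist_gt0 yzm; lia.
have zw : z != w by case/andP: so.
have zw0 := zw; rewrite -dist_gt0 in zw0.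
have so' : sorted neqr [:: x, y, z, w & r] by rewrite /= xy yz.
have sz' : size [:: x, y, z, w & r] = k.+2 by rewrite /= -sz.
have := phi_cocycle so' sz'; rewrite !codiff_cons !betweenE // xy1 yzm.
rewrite ltnn -[X in (_ <= X)%N]addn0 leq_add2l leqNgt zw0 !andbF oppr0 !sub0r opprK.
move=> h.
rewrite (@codiff_head _ (fun v => phi [:: x, y & v])); last first.
  by move=> v; move: T; rewrite /runs_after => ->.
exact: h.
Qed.

Lemma runs_after_critical x y z t : size t = k.-2 -> (1 < k)%N ->
  (if runs_after x y (critical z t) then phi [:: x, y & critical z t] else 0) = 0.
Proof.
move=> sz k1; case: ifP => //; have [r rE] : exists r, critical z t = z :: r.
  by case: (t) => [|e t']; [exists [::] | have [r ->] := critical_head z e t'; eexists].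
rewrite {1}rE /runs_after => /and3P[/eqP xy1 /eqP de /eqP yzm].
have yE := stepP xy1; have zy : z != step x (dir x y).
  by rewrite -yE eq_sym -dist_gt0 yzm; lia.
have /eqP -> : z == jump x (dir x y) by rewrite jump_step // -yE yzm de !eqxx.
by rewrite {1}yE -critical_straight phi_critical //= sz; lia.
Qed.

(** The primitives found in lower degree glue to a cochain psi whose differential agrees
with phi on all simplices that start like a critical one: a vertex put in front
changes the sign, two vertices do not. *)
Lemma first_step_reduction : (0 < k)%N ->
  (exists psi1, forall x s, sorted neqr s -> size s = k ->
     (if turns_after x s then phi (x :: s) else 0) = codiff d (psi1 x) s) ->
  (exists psi2, forall x y s, sorted neqr s -> size s = k.-1 ->
     (if runs_after x y s then phi [:: x, y & s] else 0) = codiff d (psi2 x y) s) ->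
  exists psi, forall x y v, sorted neqr [:: x, y & v] -> size [:: x, y & v] = k.+1 ->
    d x y = 1%N -> (if v is z :: _ then ~~ btw x y z else true) ->
    phi [:: x, y & v] = codiff d psi [:: x, y & v].
Proof.
move=> k0 [psi1 psi1E] [psi2 psi2E].
pose psi s := if s is x :: y :: v then
    if turns_after x (y :: v) then - psi1 x (y :: v)
    else if runs_after x y v then psi2 x y v else 0 else 0.
exists psi => x y [|z r] so sz xy1 nB.
  by rewrite /= {1}(stepP xy1) -[_ :: _]/(critical x [:: dir x y]) phi_critical //; case: sz.
rewrite codiff_cons (negPf nB) oppr0 sub0r.
have /and3P[xy yz so'] : [&& x != y, y != z & sorted neqr (z :: r)] by [].
have soy : sorted neqr [:: y, z & r] by case/andP: so.
have [de|dn] := eqVneq (dir x y) (dir y z); last first.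
  have T z' v : dir y z' = dir y z -> turns_after x [:: y, z' & v].
    by rewrite /turns_after xy1 eqxx => ->.
  rewrite (@codiff_dir _ (fun v => -1 * psi1 x v)) //; last first.
    by move=> z' v /T Tv; rewrite mulN1r /psi Tv.
  by rewrite codiffZ mulN1r opprK -psi1E ?T //; case: sz.
have yzm : d y z = m.
  by move: nB (dist_le y z); rewrite betweenE // de xy1 eqxx; lia.
have nT v : turns_after x [:: y, z & v] = false by rewrite /turns_after de eqxx andbF.
have Rn v : runs_after x y (z :: v) by rewrite /runs_after xy1 yzm de !eqxx.
have szr : size (z :: r) = k.-1 by case: sz => <-.
case: r => [|w r] in so so' soy sz szr nB *.
  by rewrite /= oppr0; have := psi2E x y _ so' szr; rewrite Rn.
have zw : z != w by case/andP: so'.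
have zw0 := zw; rewrite -dist_gt0 in zw0.
rewrite codiff_cons betweenE // yzm -[X in (_ <= X)%N]addn0 leq_add2l leqNgt zw0.
rewrite andbF oppr0 sub0r opprK (@codiff_head _ (psi2 x y)); last first.
  by move=> v; rewrite /psi nT Rn.
by rewrite -psi2E // Rn.
Qed.

End CocycleExact.

(** After subtracting the coboundary of [first_step_reduction] the cocycle phi' vanishes
on simplices that start like critical ones.  On the others, inserting the vertex
one step after x, on the geodesic from x to y, is a contracting homotopy: it
inverts the deletion of a vertex at distance 1 from x, and up to simplices on
which phi' is zero it commutes with all other deletions. *)
Theorem cocycle_exact k phi :
  (forall s, sorted neqr s -> size s = k.+2 -> codiff d phi s = 0) ->
  (forall x t, size t = k -> phi (critical x t) = 0) ->
  exists psi, forall s, sorted neqr s -> size s = k.+1 -> phi s = codiff d psi s.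
Proof.
have [j] := ubnP k; elim: j k phi => // j IH k phi kj phi_cocycle phi_critical.
case: (posnP k) => [k0|k0].
  exists (fun=> 0) => s _; rewrite k0; case: s => [|x []] //= _.
  by rewrite -[[:: x]]/(critical x [::]) phi_critical.
have [psiQ psiQE] : exists psi, forall x y v,
    sorted neqr [:: x, y & v] -> size [:: x, y & v] = k.+1 ->
    d x y = 1%N -> (if v is z :: _ then ~~ btw x y z else true) ->
    phi [:: x, y & v] = codiff d psi [:: x, y & v].
  apply: first_step_reduction => //.
    suff /choice[psi1 psi1E] : forall x, exists psi, forall s, sorted neqr s ->
        size s = k -> (if turns_after x s then phi (x :: s) else 0) = codiff d psi s.
      by exists psi1.
    move=> x.
    rewrite -(prednK k0); apply: IH; first by lia.
      by move=> s so sz; apply: (turns_after_cocycle phi_cocycle) => //; rewrite sz; lia.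
    by move=> y t sz; apply: (turns_after_critical phi_critical).
  have [k1|k1] := ltnP 1 k; last first.
    exists (fun _ _ _ => 0) => x y s _.
    by rewrite (_ : k.-1 = 0%N); [case: s | lia].
  have H x : exists psi2, forall y s, sorted neqr s -> size s = k.-1 ->
     (if runs_after x y s then phi [:: x, y & s] else 0) = codiff d (psi2 y) s.
    suff /choice[psi2 psi2E] : forall y, exists psi, forall s, sorted neqr s ->
        size s = k.-1 -> (if runs_after x y s then phi [:: x, y & s] else 0) = codiff d psi s.
      by exists psi2.
    move=> y.
    rewrite (_ : k.-1 = k.-2.+1); last by lia.
    apply: IH; first by lia.
      by move=> s so sz; apply: (runs_after_cocycle phi_cocycle) => //; rewrite sz; lia.
    by move=> z t sz; apply: (runs_after_critical phi_critical).
  by have [psi2 psi2E] := choice H; exists psi2.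
pose phi' v := phi v + -1 * codiff d psiQ v.
have phi'_cocycle s : sorted neqr s -> size s = k.+2 -> codiff d phi' s = 0.
  move=> so sz; rewrite codiffD codiffZ phi_cocycle //.
  by rewrite (codiff_codiff dist_triangle) mulr0 addr0.
have phi'Q x y v : sorted neqr [:: x, y & v] -> size [:: x, y & v] = k.+1 ->
    d x y = 1%N -> (if v is z :: _ then ~~ btw x y z else true) ->
    phi' [:: x, y & v] = 0.
  by move=> so sz xy1 nB; rewrite /phi' -psiQE // mulN1r subrr.
pose psiH s := if s is x :: y :: v then
  if d x y == 1%N then 0 else - phi' [:: x, step x (dir x y), y & v] else 0.
suff psiHE s : sorted neqr s -> size s = k.+1 -> phi' s = codiff d psiH s.
  exists (fun v => psiQ v + psiH v) => s so sz.
  by rewrite codiffD -psiHE // /phi' mulN1r addrC subrK.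
case: s => [|x [|y v]] //= so sz; first by rewrite -(prednK k0) in sz.
rewrite -[match v with [::] => _ | _ => _ end]/(codiff d psiH [:: x, y & v]).
have /andP[xy so'] : (x != y) && sorted neqr (y :: v) by [].
have [xy1|xyn] := eqVneq (d x y) 1%N.
  case: v => [|z r] in so so' sz *; first by rewrite phi'Q.
  rewrite codiff_cons (@codiff_head _ (fun=> 0)) ?codiff0 ?subr0; last first.
    by move=> v; rewrite /psiH xy1 eqxx.
  case: ifP => B; last by rewrite oppr0 phi'Q // B.
  have yz : y != z by case/andP: so'.
  have yz0 := yz; rewrite -dist_gt0 in yz0.
  rewrite /psiH (eqP B) xy1 add1n eqSS -[_ == _]negbK -lt0n yz0 opprK.
  by rewrite (between_dir xy yz B) -(stepP xy1).
have xy2 : (1 < d x y)%N by move: xy xyn; rewrite -dist_gt0; lia.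
have Bu := between_step xy2; set u := step x (dir x y) in Bu.
have xu1 : d x u = 1%N by rewrite dist_step.
have xu : x != u by rewrite -dist_gt0 xu1.
have uy : u != y by move/eqP: Bu; rewrite -dist_gt0 xu1; lia.
have so'' : sorted neqr [:: x, u, y & v] by rewrite /= xu uy.
have := phi'_cocycle _ so'' (congr1 succn sz); rewrite codiff_cons Bu.
move=> /eqP; rewrite -opprD oppr_eq0 addr_eq0 => /eqP ->.
case: v => [|z r] in so so' so'' sz *; first by rewrite /= oppr0.
have yz : y != z by case/andP: so'.
rewrite !codiff_cons opprB opprK addrC; congr (_ + _); last first.
  rewrite (@codiff_head (fun v => psiH (x :: v)) (fun v => -1 * phi' [:: x, u & v])).
    by rewrite codiffZ mulN1r opprK.
  by move=> v; rewrite /psiH (negPf xyn) mulN1r.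
have yz0 := yz; rewrite -dist_gt0 in yz0.
(* If y is geodesic between u and z but not between x and z, then u is not geodesic
   between x and z, and phi' vanishes there. *)
case: (boolP (btw x y z)) => B.
  have B' : btw u y z.
    move/eqP: B Bu => dE /eqP; rewrite /between xu1; have := dist_triangle x u z.
    by have := dist_triangle u y z; rewrite xu1 dE; lia.
  rewrite B' /psiH (between_dir xy yz B) (eqP B) ifN ?opprK // neq_ltn orbC.
  by rewrite (leq_trans xy2) // leq_addr.
case: ifP => B'; last exact: oppr0.
rewrite oppr0; apply: phi'Q; [|exact: sz|exact: xu1|].
- by move: so''; rewrite /= xu (between_neq dist_eq0 uy B') => /and3P[_ _ /andP[_]].
- move/eqP: B' => dE; move: B; apply: contra => /eqP; rewrite /between dE xu1.
  by move/eqP: Bu; rewrite xu1 => -> ->; rewrite addnA.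
Qed.

(** * Words in the generators as cocycles *)

Local Notation G := (gen n m).
Local Notation A := {malg {fmonom G}}.
Local Notation nat_length := (nat_length d).

Definition gen_len (g : G) : nat :=
  match g with inl (inl _) => 0 | inl (inr _) => 1 | inr _ => m.+1 end.

(** The cochain of a generator of degree 2 admits every middle vertex y on the long way
from x to z: with a single choice of y it would not be a cocycle. *)
Definition gen_val (g : G) (s : seq X) : int :=
  match g with
  | inl (inl x) => (s == [:: x])%:R
  | inl (inr p) => (s == [:: (val p).1; (val p).2])%:R
  | inr p => if s is [:: x; y; z] then
      [&& x == (val p).1, z == (val p).2 & (d x y + d y z == m.+1)%N]%:R else 0
  end.

(** The cup product of the generators; the empty word gives the unit cochain. *)
Fixpoint word_val (w : seq G) (s : seq X) : int :=
  if w is g :: w' then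
    gen_val g (take (gen_degk g).+1 s) * word_val w' (drop (gen_degk g) s)
  else (size s == 1)%:R.

Definition word_length (w : seq G) : nat := (\sum_(g <- w) gen_len g)%N.
Definition word_degree (w : seq G) : nat := (\sum_(g <- w) gen_degk g)%N.

Lemma gen_val_supp g s : gen_val g s != 0 ->
  size s = (gen_degk g).+1 /\ nat_length s = gen_len g.
Proof.
case: g => [[x|[[x y] /= xy]]|[[x z] /= xz]]; rewrite /gen_val /=.
- by have [->|] := s =P _.
- by have [->|] := s =P _; rewrite /= ?addn0 //; move: xy; rewrite adjE => /eqP.
case: s => [|x' [|y [|z' [|]]]] //=; case: and3P => // -[_ _ /eqP h] _.
by rewrite !addn0.
Qed.

Lemma word_val_supp w s : word_val w s != 0 ->
  size s = (word_degree w).+1 /\ nat_length s = word_length w.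
Proof.
rewrite /word_degree /word_length; elim: w s => [|g w IH] s /=.
  by rewrite !big_nil; case: s => [|x [|y s]].
rewrite mulf_eq0 negb_or => /andP[/gen_val_supp[s1 l1] /IH[s2 l2]].
rewrite !big_cons -l1 -l2 length_split; split=> //.
by move: s2; rewrite size_drop; lia.
Qed.

(** The cup product, summed over all bidegrees. *)
Definition convolution (phi psi : seq X -> int) (s : seq X) : int :=
  \sum_(i < size s) phi (take i.+1 s) * psi (drop i s).

Lemma convolution_supp k phi psi s :
  (forall s, phi s != 0 -> size s = k.+1) ->
  convolution phi psi s = phi (take k.+1 s) * psi (drop k s).
Proof.
move=> H; have H0 v : size v != k.+1 -> phi v = 0.
  by move=> sz; apply/eqP; apply: contraNT sz => /H ->.
rewrite /convolution; have [ks|ks] := ltnP k (size s).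
  rewrite (bigD1 (Ordinal ks)) //= big1 ?addr0 // => i; rewrite -val_eqE /= => ik.
  by rewrite H0 ?mul0r // size_takel // eqSS.
rewrite H0 ?mul0r; last by rewrite take_oversize ?(leq_trans ks) //; lia.
rewrite big1 // => i _; rewrite H0 ?mul0r // size_take_min; case: i => i /= h; lia.
Qed.

Lemma word_val_cat u v s :
  word_val (u ++ v) s = convolution (word_val u) (word_val v) s.
Proof.
rewrite (@convolution_supp (word_degree u)); last by move=> s' /word_val_supp[].
elim: u s => [|g u IH] s.
  rewrite /word_degree big_nil drop0 /=; case: s => [|x s].
    by rewrite mul0r; apply/eqP; apply: contraT => /word_val_supp[].
  by rewrite /= take0 mul1r.
rewrite /= IH /word_degree big_cons -/(word_degree u) mulrA.
rewrite take_takel ?ltnS ?leq_addr // drop_drop [(word_degree u + _)%N]addnC.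
by rewrite take_drop addSn [(word_degree u + _)%N]addnC.
Qed.

Lemma word_val_gen g s : word_val [:: g] s = gen_val g s.
Proof.
rewrite /=; have [sz|sz] := eqVneq (size s) (gen_degk g).+1.
  by rewrite take_oversize ?sz // size_drop sz subSn // subnn mulr1.
have -> : gen_val g s = 0 by apply/eqP; apply: contraNT sz => /gen_val_supp[->].
rewrite size_drop; case: eqP => h; last by rewrite mulr0.
by case/eqP: sz; lia.
Qed.

Definition eval_at (s : seq X) : {additive A -> int} :=
  fgext (fun w : {fmonom G} => word_val w s).

Lemma eval_at_word w s : eval_at s << w >> = word_val w s.
Proof. exact: fgextU. Qed.

Lemma eval_at_gen g s : eval_at s << fmu g >> = gen_val g s.
Proof. by rewrite eval_at_word fmU word_val_gen. Qed.

Lemma eval_atM f g s : eval_at s (f * g) = convolution (eval_at^~ f) (eval_at^~ g) s.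
Proof.
elim/malg_ind: f => [|u|f1 f2 H1 H2].
- by rewrite mul0r raddf0 /convolution big1 // => i _; rewrite raddf0 mul0r.
- elim/malg_ind: g => [|v|g1 g2 H1 H2].
  + by rewrite mulr0 raddf0 /convolution big1 // => i _; rewrite raddf0 mulr0.
  + rewrite malgUM eval_at_word fmM word_val_cat.
    by apply: eq_bigr => i _; rewrite !eval_at_word.
  + rewrite mulrBr (raddfB (eval_at s)).
    apply: etrans (congr2 (fun a b => a - b) H1 H2) _.
    rewrite -sumrB; apply: eq_bigr => i _.
    by rewrite (raddfB (eval_at _)) mulrBr.
- rewrite mulrBl (raddfB (eval_at s)).
  apply: etrans (congr2 (fun a b => a - b) H1 H2) _.
  rewrite -sumrB; apply: eq_bigr => i _.
  by rewrite (raddfB (eval_at _)) mulrBl.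
Qed.

Lemma eval_at_genM g f s : eval_at s (<< fmu g >> * f) =
  gen_val g (take (gen_degk g).+1 s) * eval_at (drop (gen_degk g) s) f.
Proof.
rewrite eval_atM (@convolution_supp (gen_degk g)) ?eval_at_gen // => v.
by rewrite eval_at_gen => /gen_val_supp[].
Qed.

Lemma eval_at_gen2 g h s : eval_at s (<< fmu g >> * << fmu h >>) =
  gen_val g (take (gen_degk g).+1 s) * gen_val h (drop (gen_degk g) s).
Proof. by rewrite eval_at_genM eval_at_gen. Qed.

(** A Leibniz rule for a generator in front.  The deletions inside the piece read by
the generator vanish for degrees 0 and 1, an edge having no geodesic interior
vertex, and cancel in pairs for degree 2 by [detour_coherent]. *)
Lemma gen_cocycle g psi s : sorted neqr s ->
  (forall v, sorted neqr v -> codiff d psi v = 0) ->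
  codiff d (fun v => gen_val g (take (gen_degk g).+1 v) * psi (drop (gen_degk g) v)) s = 0.
Proof.
move=> so psi0; case: s so => [|p s] // so.
case: g => [[x|[[x y] xy]]|[[x z] xz]]; rewrite /gen_degk.
- rewrite (@codiff_head _ (fun v => (p == x)%:R * psi v)).
    by rewrite codiffZ psi0 // mulr0.
  by move=> v; rewrite /= take0 eqseq_cons andbT.
- case: s so => [|q [|r s]] // so; rewrite codiff_cons.
  rewrite (@codiff_head _ (fun v => (([:: p; q] == [:: x; y])%:R * psi v))); last first.
    by move=> v; rewrite /= take0.
  rewrite codiffZ psi0 ?mulr0 ?subr0; last by case/andP: so.
  apply/eqP; rewrite oppr_eq0; case: ifP => // /eqP B.
  rewrite /gen_val /= take0; case: ([:: p; r] =P _) => [[pE rE]|_]; last by rewrite mul0r.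
  move: xy => /=; rewrite adjE -pE -rE => /eqP h; move: B; rewrite h.
  by case/and3P: so; rewrite -!dist_gt0; lia.
- case: s so => [|q [|r [|u s]]] // so.
    by rewrite /=; case: ifP => _; rewrite ?mul0r oppr0 subr0.
  rewrite !codiff_cons.
  have /and4P[pq qr ru _] := so.
  have -> : codiff d (fun v => gen_val (inr (exist _ (x, z) xz)) (take 3 [:: p, q & v])
      * psi (drop 2 [:: p, q & v])) [:: r, u & s] = 0.
    rewrite (@codiff_head _ (fun v => gen_val (inr (exist _ (x, z) xz)) [:: p; q; r] * psi v)).
      by rewrite codiffZ psi0 ?mulr0 //; case/and3P: so.
    by move=> v; rewrite /= take0.
  rewrite [X in _ - X]subr0 opprK /gen_val /= ?take0.
  case: (p =P x) => [pE|_]; last first.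
    by rewrite /= ?mulr0n; do 2 case: ifP => _; rewrite ?mul0r ?oppr0 ?addr0.
  case: (u =P z) => [uE|_]; last first.
    by rewrite /= ?mulr0n; do 2 case: ifP => _; rewrite ?mul0r ?oppr0 ?addr0.
  have pum : d p u = m by rewrite pE uE (eqP xz).
  have := detour_coherent pq qr ru pum.
  case: (btw p q r); case: (btw q r u) => /=.
  - by move=> ->; rewrite addNr.
  - by move=> ->; rewrite mul0r oppr0 addr0.
  - by move=> <-; rewrite mul0r oppr0 addr0.
  - by rewrite oppr0 addr0.
Qed.

Lemma word_cocycle w s : sorted neqr s -> codiff d (word_val w) s = 0.
Proof.
elim: w s => [|g w IH] s so; last exact: gen_cocycle.
apply: codiff_eq0 => v; rewrite /word_val.
by case=> // x v' s' [] // [] //.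
Qed.

Lemma eval_at_cocycle f s : sorted neqr s -> codiff d (eval_at^~ f) s = 0.
Proof.
move=> so; elim/malg_ind: f => [|w|f g f0 g0].
- by rewrite -[RHS](codiff0 d s); apply: codiff_local => v _; rewrite raddf0.
- by rewrite -[RHS](word_cocycle w so); apply: codiff_local => v _; rewrite eval_at_word.
have -> : codiff d (eval_at^~ (f - g)) s =
    codiff d (fun v => eval_at v f + -1 * eval_at v g) s.
  by apply: codiff_local => v _; rewrite (raddfB (eval_at v)) mulN1r.
by rewrite codiffD codiffZ f0 g0 mulr0 addr0.
Qed.

(** * The ideal vanishes on rigid simplices *)

Lemma step_back x e : step (step x e) (~~ e) = x.
Proof. by rewrite /step /unit_step; case: e; rewrite ?addrK ?subrK. Qed.

Lemma adj_between x y z : d x y = 1%N -> d y z = 1%N -> x <> z -> btw x y z.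
Proof.
move=> xy yz xz; rewrite betweenE -?dist_gt0 ?xy ?yz //.
have [de|dn] := eqVneq (dir x y) (dir y z); first by rewrite hm.
have dE : dir y z = ~~ dir x y by move: dn; case: (dir x y); case: (dir y z).
by case: xz; rewrite (stepP yz) dE {1}(stepP xy) step_back.
Qed.

(** The relation between a b and b a at a rigid simplex of degree 3: the product
a b reads steps 1, i, m.+1 - i and b a reads i, m.+1 - i, 1; rigidity forces both
to be 1, m, 1. *)
Lemma rigid_shift w e q r u :
  w != q -> q != r -> r != u -> ~~ btw w q r -> ~~ btw q r u ->
  u = step (jump w e) e ->
  (q == step w e) && (d q r + d r u == m.+1)%N =
  (r == jump w e) && (d w q + d q r == m.+1)%N.
Proof.
move=> wq qr ru nB1 nB2 uE; apply/andP/andP => -[/eqP E /eqP s].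
  have [d1 d2] : dir q r = e /\ dir r u = e.
    by apply: detour_dir s; rewrite uE E step_jump.
  have wq1 : d w q = 1%N by rewrite E dist_step.
  have qrm : d q r = m.
    move: nB1 (dist_le q r); rewrite betweenE // wq1 d1 E dir_step eqxx -E /=.
    lia.
  have rn : r != step w e by rewrite -E eq_sym.
  by rewrite jump_step // -E d1 qrm wq1 !eqxx.
have [d1 d2] := detour_dir E s.
have ru1 : d r u = 1%N by rewrite uE E dist_step.
have qrm : d q r = m.
  move: nB2 (dist_le q r); rewrite betweenE // ru1 d2.
  by rewrite uE E dir_step eqxx /=; lia.
have wq1 : d w q = 1%N by lia.
by rewrite (stepP wq1) d1 -d1 -(stepP wq1) qrm ru1 addn1 !eqxx.
Qed.

(** Most relations are zero as cochains.  The relation for a a and the one for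
a b - b a are only coboundaries, and coboundaries vanish on rigid simplices. *)
Lemma rels_rigid f s : cycle_rels f -> sorted neqr s -> rigid d s -> eval_at s f = 0.
Proof.
have conv1 (x y : int) : x == y -> x - y = 0 by move=> /eqP ->; rewrite subrr.
case=> {f} [x|x y xy|x y xy|x y xy|x z xz|x z xz|x y z xy yz xz|].
- move=> _ _; rewrite (raddfB (eval_at s)) eval_at_genM !eval_at_gen; apply: conv1.
  case: s => [|a [|b s]] //=; rewrite ?take0 !eqseq_cons ?andbF ?andbT;
  by case: (a == x).
- move=> _ _; rewrite eval_at_genM eval_at_gen.
  case: s => [|a s] //=; rewrite ?take0 !eqseq_cons andbT.
  case: (a =P x) => [->|_]; last by rewrite mul0r.
  by case: (x =P y); rewrite ?mulr0.
- move=> _ _; rewrite (raddfB (eval_at s)) eval_at_genM !eval_at_gen; apply: conv1.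
  case: s => [|a s] //=; rewrite ?take0 !eqseq_cons andbT.
  by case: (a == x); case: (s == _).
- move=> _ _; rewrite (raddfB (eval_at s)) eval_at_genM !eval_at_gen; apply: conv1.
  case: s => [|a [|b [|c s]]] //=; rewrite ?take0 ?drop0 !eqseq_cons ?andbF //.
    by case: (a == x); case: (b == y).
  by rewrite mulr0.
- move=> _ _; rewrite (raddfB (eval_at s)) eval_at_genM !eval_at_gen; apply: conv1.
  case: s => [|a [|b [|c [|]]]] //=; rewrite ?take0 ?mulr0 // eqseq_cons andbT.
  by case: (a == x); rewrite ?mul1r ?mul0r.
- move=> _ _; rewrite (raddfB (eval_at s)) eval_at_genM !eval_at_gen; apply: conv1.
  case: s => [|a [|b [|c [|e s]]]] //=; rewrite ?take0 ?mul0r // eqseq_cons.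
    by case: (c == z); rewrite ?mulr1 // andbF mul0r.
  by rewrite andbF mulr0.
- have := xy; have := yz; rewrite !adjE => /eqP yz1 /eqP xy1.
  rewrite eval_at_genM eval_at_gen.
  case: s => [|a [|b [|c [|e s]]]] //=.
  + by rewrite eqseq_cons !andbF mul0r.
  + by rewrite !eqseq_cons andbF mulr0.
  + move=> _ /andP[nB _]; rewrite ?take0 !eqseq_cons !andbT.
    case: (a =P x) => [aE|_]; last by rewrite mul0r.
    case: (b =P y) => [bE|_]; last by rewrite mul0r.
    case: (c =P z) => [cE|_]; last by rewrite mulr0.
    by rewrite aE bE cE adj_between in nB.
  + by rewrite ?take0 !eqseq_cons !andbF mulr0.
move=> w x y z eps epsE xE yE zE wx xz wy yz so rs.
have [e eE] : exists e, eps = unit_step e by case: epsE => ->; [exists true|exists false].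
rewrite (raddfB (eval_at s)); apply/eqP; rewrite subr_eq0; apply/eqP.
apply: etrans (eval_at_gen2 _ _ s) _; apply: etrans _ (esym (eval_at_gen2 _ _ s)).
have {}xE : x = step w e by rewrite xE eE /step.
have {}yE : y = jump w e by rewrite yE xE eE /step /jump mulrS addrA.
have {}zE : z = step (jump w e) e by rewrite zE yE eE /step.
case: s so rs => [|p [|q [|r [|u [|v s]]]]] //=; rewrite ?take0 ?mul0r ?mulr0 //.
- by rewrite !eqseq_cons !andbF mulr0.
- move=> /and4P[pq qr ru _] /andP[nB1 /andP[nB2 _]].
  rewrite !eqseq_cons !andbT; case: (p =P w) => [pE|_]; last by rewrite !mul0r.
  case: (u =P z) => [uE|_]; last by rewrite !andbF mulr0 mulr0.
  rewrite pE in pq nB1 *; have := rigid_shift (e := e) pq qr ru nB1 nB2.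
  rewrite -zE -yE -xE => /(_ uE).
  case: (q == x); case: (r == y) => /=.
  + by move=> ->; rewrite mul1r mulr1.
  + by move=> ->; rewrite mulr0 mul0r.
  + by move=> <-; rewrite mulr0 mul0r.
  + by move=> _; rewrite ?mul0r ?mulr0.
- by rewrite !eqseq_cons !andbF mulr0.
Qed.

Local Notation idl := (ideal (@cycle_rels n m)).

(** Pieces of a rigid simplex are rigid, so vanishing on rigid simplices passes to
products on either side. *)
Lemma ideal_rigid f s : idl f -> sorted neqr s -> rigid d s ->
  eval_at s f = 0.
Proof.
move=> fI; elim: fI s => {f} [f fr||f g _ IHf _ IHg|f g _ _ IH|f g _ IH _] s so rs.
- exact: rels_rigid.
- by rewrite raddf0.
- by rewrite (raddfB (eval_at s)) IHf // IHg // subrr.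
- rewrite eval_atM /convolution big1 // => i _; rewrite IH ?mulr0 //.
    exact: drop_sorted.
  exact: rigid_drop.
- rewrite eval_atM /convolution big1 // => i _; rewrite IH ?mul0r //.
    exact: take_sorted.
  exact: rigid_take.
Qed.

(** * Normal forms *)

Lemma adj_step x e : cycle_adj x (step x e).
Proof. by rewrite adjE dist_step. Qed.

Lemma far_jump x e : cycle_dist x (jump x e) == m.
Proof. by rewrite dist_jump. Qed.

Local Notation gen_vertex := (@gen_e n m).
Definition gen_step x e : A := gen_a m (adj_step x e).
Definition gen_jump x e : A := gen_b (far_jump x e).

(** The word for a run of r equal directions is b...b when r is even and b...b a when r
is odd.  A final a is completed by its target so that every normal form ends in
the same way, which is why the one-letter word carries a vertex generator. *)
Fixpoint normal_form (x : X) (t : seq bool) : A :=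
  if t is e :: t' then
    if t' is e' :: r then
      if e == e' then gen_jump x e * normal_form (jump x e) r
      else gen_step x e * normal_form (step x e) t'
    else gen_step x e * gen_vertex (step x e)
  else gen_vertex x.

Arguments normal_form : simpl never.

Lemma normal_form_turn x e t : ohead t != Some e ->
  normal_form x (e :: t) = gen_step x e * normal_form (step x e) t.
Proof.
case: t => [|e' t] h; first by reflexivity.
change (normal_form x [:: e, e' & t]) with
  (if e == e' then gen_jump x e * normal_form (jump x e) t
   else gen_step x e * normal_form (step x e) (e' :: t)).
case: (e =P e') h => [<- h | _ _]; last by reflexivity.
by exfalso; rewrite /= eqxx in h.
Qed.

Lemma normal_form_straight x e t :
  normal_form x [:: e, e & t] = gen_jump x e * normal_form (jump x e) t.
Proof.
change (normal_form x [:: e, e & t]) with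
  (if e == e then gen_jump x e * normal_form (jump x e) t
   else gen_step x e * normal_form (step x e) (e :: t)).
by rewrite eqxx.
Qed.

(** A generator of degree 2 can only read two steps of the direction of its jump
([detour_dir]), so the start and the directions of s determine the normal form
that is nonzero at s. *)
Lemma normal_form_supp s x t : eval_at s (normal_form x t) != 0 ->
  exists2 r, s = x :: r & dirs s = t.
Proof.
elim/signs_ind: t s x => [|e t h IH|e t IH] s x.
- by rewrite eval_at_gen /=; case: (s =P _) => // -> _; exists [::].
- rewrite normal_form_turn // eval_at_genM mulf_eq0 negb_or => /andP[+ /IH[r]].
  case: s => [|a [|b s]] //=; rewrite ?take0 !eqseq_cons ?andbF //.
  case: (a =P x) => // -> + [bE _] dE; rewrite bE => _.
  by exists (step x e :: s); rewrite // dir_step -bE dE.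
rewrite normal_form_straight eval_at_genM mulf_eq0 negb_or => /andP[+ /IH[r]].
case: s => [|a [|b [|c s]]] //=; rewrite ?take0.
case: and3P => // -[/eqP aE /eqP cE /eqP dE] _ _ dsE; rewrite -aE in cE.
have [d1 d2] := detour_dir cE dE.
by exists [:: b, c & s]; rewrite -?aE // dsE d1 d2.
Qed.

Lemma normal_form_critical1 x t : eval_at (critical x t) (normal_form x t) = 1.
Proof.
elim/signs_ind: t x => [|e t h IH|e t IH] x.
- by rewrite eval_at_gen /= eqxx.
- rewrite normal_form_turn // critical_turn // eval_at_genM /= drop0 IH mulr1.
  by have [r ->] := critical_cons (step x e) t; rewrite /= take0 eqxx.
rewrite normal_form_straight critical_straight eval_at_genM /= drop0 IH mulr1.
have [r ->] := critical_cons (jump x e) t.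
by rewrite /= take0 dist_step dist_step_jump !eqxx.
Qed.

(** Duality makes the normal forms independent modulo the ideal and yields the
coefficients in [normal_part]. *)
Lemma normal_form_critical x t x' t' :
  eval_at (critical x' t') (normal_form x t) = ((x', t') == (x, t))%:R.
Proof.
case: eqP => [[-> ->]|ne]; first exact: normal_form_critical1.
apply/eqP; apply: contra_notT ne => /normal_form_supp[r]; rewrite dirs_critical => + ->.
by have [r' ->] := critical_cons x' t' => -[->].
Qed.

Lemma normal_form_word x t : exists2 w : {fmonom G}, w != mone & normal_form x t = << w >>.
Proof.
have H g (f : A) : (exists2 w : {fmonom G}, w != mone & f = << w >>) ->
    exists2 w : {fmonom G}, w != mone & << fmu g >> * f = << w >>.
  case=> w _ ->; exists (mmul (fmu g) w); last by rewrite malgUM.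
  by rewrite fmP fmM fmU fm1.
have H0 g : exists2 w : {fmonom G}, w != mone & << fmu g >> = << w >> :> A.
  by exists (fmu g); rewrite // fmP fmU fm1.
elim/signs_ind: t x => [|e t h IH|e t IH] x; first exact: H0.
  by rewrite normal_form_turn //; apply: H.
by rewrite normal_form_straight; apply: H.
Qed.

Lemma word_nonunital (w : {fmonom G}) : w != mone -> (<< w >> : A) \in @nonunital (gen n m).
Proof. by move=> w1; rewrite inE mcoeffU1 (negPf w1). Qed.

Lemma normal_form_nonunital x t : normal_form x t \in @nonunital (gen n m).
Proof. by have [w w1 ->] := normal_form_word x t; exact: word_nonunital. Qed.

Lemma gen_nonunital g : (<< fmu g >> : A) \in @nonunital (gen n m).
Proof. by apply: word_nonunital; rewrite fmP fmU fm1. Qed.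

Definition eqm (f g : A) : Prop := idl (f - g).

Lemma idealN (f : A) : idl f -> idl (- f).
Proof. by move=> fI; rewrite -sub0r; apply: idealB fI; exact: ideal0. Qed.

Lemma idealD (f g : A) : idl f -> idl g ->
  idl (f + g).
Proof. by move=> fI gI; rewrite -[g]opprK; apply/idealB/idealN. Qed.

Lemma eqm_refl f : eqm f f.
Proof. by rewrite /eqm subrr; exact: ideal0. Qed.

Lemma eqm_sym f g : eqm f g -> eqm g f.
Proof. by move=> h; rewrite /eqm -opprB; exact: idealN. Qed.

Lemma eqm_trans f g h : eqm f g -> eqm g h -> eqm f h.
Proof.
by move=> fg gh; have := idealD fg gh; rewrite addrA subrK.
Qed.

Lemma eqm_ideal f g : eqm f g -> idl g -> idl f.
Proof. by move=> fg gI; rewrite -(subrK g f); exact: idealD. Qed.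

Lemma eqm_mull f g h : f \in @nonunital (gen n m) -> eqm g h -> eqm (f * g) (f * h).
Proof. by move=> fn gh; rewrite /eqm -mulrBr; exact: idealMl. Qed.

Lemma eqm_mulr f g h : h \in @nonunital (gen n m) -> eqm f g -> eqm (f * h) (g * h).
Proof. by move=> hn' fg; rewrite /eqm -mulrBl; exact: Defs.idealMr fg hn'. Qed.

Lemma gen_step_target x e : eqm (gen_step x e) (gen_step x e * gen_vertex (step x e)).
Proof. exact/ideal_rel/rel_ae. Qed.

Lemma gen_jump_target x e : eqm (gen_jump x e) (gen_jump x e * gen_vertex (jump x e)).
Proof. exact/ideal_rel/rel_be. Qed.

Lemma gen_step_source x e : eqm (gen_vertex x * gen_step x e) (gen_step x e).
Proof. exact/eqm_sym/ideal_rel/rel_ea. Qed.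

Lemma gen_jump_source x e : eqm (gen_vertex x * gen_jump x e) (gen_jump x e).
Proof. exact/eqm_sym/ideal_rel/rel_eb. Qed.

(** The target is a variable here, so that it can be replaced without rewriting inside
the proof of adjacency. *)
Lemma gen_a_eq (x y y' : X) (xy : cycle_adj x y) (xy' : cycle_adj x y') :
  y = y' -> gen_a m xy = gen_a m xy'.
Proof. by move=> yE; subst y'; rewrite (bool_irrelevance xy xy'). Qed.

(** Both products lead from x to the vertex m + 2 steps further, which is reached as
[step (jump x e) e] and as [jump (step x e) e]. *)
Lemma gen_step_jump x e :
  eqm (gen_step x e * gen_jump (step x e) e) (gen_jump x e * gen_step (jump x e) e).
Proof.
have adj : cycle_adj (jump x e) (jump (step x e) e) by rewrite -step_jump adj_step.
rewrite /gen_step -(gen_a_eq adj); last by rewrite step_jump.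
apply/ideal_rel/(@rel_ab n m x (step x e) (jump x e) _ (unit_step e)) => //.
- by case: (e); [left|right].
- by rewrite /step /jump mulrS addrA.
- by rewrite -step_jump.
Qed.

Lemma gen_step_step x e :
  idl (gen_step x e * gen_step (step x e) e).
Proof.
apply/ideal_rel/rel_aa => E; have := dist_xx x; rewrite {2}E.
have ss : btw x (step x e) (step (step x e) e).
  by rewrite betweenE ?step_neq // !dir_step !dist_step eqxx hm.
by rewrite (eqP ss) dist_step.
Qed.

Lemma gen_vertex_normal x t :
  eqm (gen_vertex x * normal_form x t) (normal_form x t).
Proof.
elim/signs_ind: t => [|e t h _|e t _]; first exact/ideal_rel/rel_ee.
  by rewrite normal_form_turn // mulrA; apply/eqm_mulr/gen_step_source/normal_form_nonunital.
by rewrite normal_form_straight mulrA; apply/eqm_mulr/gen_jump_source/normal_form_nonunital.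
Qed.

Lemma gen_vertex_normal0 x y t : y <> x ->
  idl (gen_vertex y * normal_form x t).
Proof.
move=> yx; apply: eqm_ideal (eqm_mull (gen_nonunital _) (eqm_sym (gen_vertex_normal x t))) _.
by rewrite mulrA; apply: Defs.idealMr (normal_form_nonunital _ _); apply/ideal_rel/rel_ee0.
Qed.

Definition reduces k x f : Prop :=
  idl f \/ exists2 t, size t = k & eqm f (normal_form x t).

(** In front of a run of the same direction, a moves behind all the b's; there it meets
another a of this direction, giving zero, or completes the run. *)
Lemma gen_step_normal x e t :
  reduces (size t).+1 x (gen_step x e * normal_form (step x e) t).
Proof.
elim/signs_ind: t x e => [|e' t h _|e' t IH] x e.
- by right; exists [:: e] => //; exact: eqm_refl.
- have [E|ne] := eqVneq e' e.
    left; rewrite normal_form_turn // -E mulrA.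
    exact/Defs.idealMr/normal_form_nonunital/gen_step_step.
  right; exists [:: e, e' & t] => //; rewrite -normal_form_turn; first exact: eqm_refl.
  by apply: contra ne => /eqP[->].
have [E|ne] := eqVneq e' e; last first.
  right; exists [:: e, e', e' & t] => //; rewrite -normal_form_turn; first exact: eqm_refl.
  by apply: contra ne => /eqP[->].
have H : eqm (gen_step x e * normal_form (step x e) [:: e', e' & t])
    (gen_jump x e * (gen_step (jump x e) e * normal_form (step (jump x e) e) t)).
  rewrite E normal_form_straight !mulrA -step_jump.
  exact/eqm_mulr/gen_step_jump/normal_form_nonunital.
case: (IH (jump x e) e) => [I|[t' tE tq]].
  left; apply: eqm_ideal H _; exact: idealMl (gen_nonunital _) I.
right; exists [:: e, e & t']; first by rewrite /= tE.
apply: eqm_trans H _; rewrite normal_form_straight.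
exact: eqm_mull (gen_nonunital _) tq.
Qed.

Lemma gen_cases (g : G) :
  [\/ exists x, << fmu g >> = gen_vertex x /\ gen_degk g = 0%N,
      exists x e, << fmu g >> = gen_step x e /\ gen_degk g = 1%N |
      exists x e, << fmu g >> = gen_jump x e /\ gen_degk g = 2%N].
Proof.
case: g => [[x|[[x y] /= xy]]|[[x z] /= xz]].
- by apply: Or31; exists x.
- apply: Or32; exists x, (dir x y); split=> //.
  rewrite -[LHS]/(gen_a m xy); apply: gen_a_eq; apply: stepP; apply/eqP.
  by rewrite -adjE.
apply: Or33; exists x, (~~ dir x z); split=> //; have zE := jumpP (eqP xz).
rewrite -[LHS]/(gen_b xz) /gen_jump; move: (far_jump x (~~ dir x z)); rewrite -zE => xz'.
by rewrite (bool_irrelevance xz xz').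
Qed.

Lemma gen_normal g x t :
  exists y, reduces (gen_degk g + size t) y (<< fmu g >> * normal_form x t).
Proof.
case: (gen_cases g) => [[y]|[y [e]]|[y [e]]] [gE ->]; exists y; rewrite gE.
- have [->|/eqP yx] := eqVneq y x; last by left; exact: gen_vertex_normal0.
  by right; exists t => //; exact: gen_vertex_normal.
- have [<-|/eqP yx] := eqVneq (step y e) x; first exact: gen_step_normal.
  left; apply: eqm_ideal (eqm_mulr (normal_form_nonunital _ _) (gen_step_target y e)) _.
  by rewrite -mulrA; apply: idealMl (gen_nonunital _) (gen_vertex_normal0 _ yx).
have [<-|/eqP yx] := eqVneq (jump y e) x.
  by right; exists [:: e, e & t] => //; rewrite normal_form_straight; exact: eqm_refl.
left; apply: eqm_ideal (eqm_mulr (normal_form_nonunital _ _) (gen_jump_target y e)) _.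
by rewrite -mulrA; apply: idealMl (gen_nonunital _) (gen_vertex_normal0 _ yx).
Qed.

Lemma word_reduces (w : seq G) : w != [::] ->
  exists x, reduces (word_degree w) x << FMonom w >>.
Proof.
elim: w => // g w IH _; rewrite /word_degree big_cons -/(word_degree w).
case: w IH => [_|g' w /(_ isT)[x]].
  rewrite /word_degree big_nil addn0 -fmuE.
  case: (gen_cases g) => [[y]|[y [e]]|[y [e]]] [gE ->]; exists y; rewrite gE; right.
  - by exists [::] => //; exact: eqm_refl.
  - by exists [:: e] => //; exact: gen_step_target.
  - by exists [:: e; e] => //; rewrite normal_form_straight; exact: gen_jump_target.
have -> : << FMonom (g :: g' :: w) >> = << fmu g >> * << FMonom (g' :: w) >> :> A.
  by rewrite malgUM; congr (<< _ >>); apply/eqP; rewrite fmP fmM fmU.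
case=> [I|[t <- tq]].
  by exists x; left; exact: idealMl (gen_nonunital _) I.
have [y [I|[t' tE tq']]] := gen_normal g x t; exists y.
  by left; apply: eqm_ideal (eqm_mull (gen_nonunital _) tq) I.
right; exists t'; first exact: tE.
exact: eqm_trans (eqm_mull (gen_nonunital _) tq) tq'.
Qed.

(** * The isomorphism *)

Lemma ideal_sum (I : Type) (r : seq I) (P : pred I) (F : I -> A) :
  (forall i, P i -> idl (F i)) -> idl (\sum_(i <- r | P i) F i).
Proof. by move=> H; elim/big_ind: _ => //; [exact: ideal0 | exact: idealD]. Qed.

Lemma idealMz f z : idl f -> idl (f *~ z).
Proof.
move=> fI; have H i : idl (f *+ i).
  by elim: i => [|i IH]; rewrite ?mulr0n ?mulrS; [exact: ideal0 | exact: idealD].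
by case: z => i; [exact: H | rewrite NegzE mulrNz; exact/idealN/H].
Qed.

(** The expansion of f in the basis of normal forms, whose coefficients are read off at
the dual critical simplices. *)
Definition normal_part k (f : A) : A :=
  \sum_(c : X * k.-tuple bool) normal_form c.1 c.2 *~ eval_at (critical c.1 c.2) f.

Lemma eval_at_critical_eqm x t f g : eqm f g ->
  eval_at (critical x t) f = eval_at (critical x t) g.
Proof.
move=> fg; apply/eqP; rewrite -subr_eq0 -(raddfB (eval_at _)).
by apply/eqP/(ideal_rigid fg); [exact: critical_sorted | exact: critical_rigid].
Qed.

Lemma normal_part_word k (w : {fmonom G}) : w != mone -> word_degree w = k ->
  idl (<< w >> - normal_part k << w >>).
Proof.
case: w => w; rewrite fmP fm1 /= => w1 wk.
have [x [I|[t sz tq]]] := word_reduces w1.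
  rewrite /normal_part big1 ?subr0 // => c _.
  by rewrite (ideal_rigid I) ?mulr0z //; [exact: critical_sorted | exact: critical_rigid].
rewrite wk in sz; have /eqP sz' := sz.
have -> : normal_part k << FMonom w >> = normal_form x t; last exact: tq.
rewrite /normal_part (bigD1 (x, Tuple sz')) //= big1 => [|c cn].
  by rewrite addr0 (eval_at_critical_eqm _ _ tq) normal_form_critical1 mulr1z.
rewrite (eval_at_critical_eqm _ _ tq) normal_form_critical.
case: eqP => [[c1 c2]|_]; last by rewrite mulr0z.
case/negP: cn; apply/eqP; case: c c1 c2 => c1 c2 /= -> E.
by congr pair; apply: val_inj.
Qed.

Section Grading.
Variable R : realType.
Local Notation D := (@cycle_metric n R).
Local Notation hom_part := (homog (@gen_degk n m) (@gen_degl n m R)).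
Local Notation chain_at k l := (simplex_chain D k l).

Lemma word_deglE (w : {fmonom G}) : word_degl (@gen_degl n m R) w = (word_length w)%:R.
Proof.
rewrite /word_degl /word_length natr_sum; apply: eq_bigr => g _.
by case: g => [[]|].
Qed.

Lemma eval_atE s f : eval_at s f = \sum_(w <- msupp f) word_val (w : {fmonom G}) s *~ f@_w.
Proof. by []. Qed.

Lemma eval_at_homog k l f s : f \in hom_part k l -> eval_at s f != 0 ->
  size s = k.+1 /\ (nat_length s)%:R = l.
Proof.
rewrite inE => /allP fP ne.
have [w wf wne] : exists2 w, w \in (msupp f : seq _) & word_val (w : {fmonom G}) s != 0.
  apply/hasP; apply: contraNT ne => /hasPn H.
  by rewrite eval_atE big1_seq // => w /andP[_ /H]; rewrite negbK => /eqP ->; rewrite mul0rz.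
have [-> ->] := word_val_supp wne; have /and3P[_ /eqP wk /eqP wl] := fP _ wf.
by rewrite -wl word_deglE -wk.
Qed.

(** For homogeneous f one term of the convolution survives: the one that cuts s after
the degree of f. *)
Lemma eval_at_homogM k l f g s : f \in hom_part k l ->
  eval_at s (f * g) = eval_at (take k.+1 s) f * eval_at (drop k s) g.
Proof. by move=> fh; rewrite eval_atM (@convolution_supp k) // => v /(eval_at_homog fh)[]. Qed.

Lemma normal_part_homog k l f : f \in hom_part k l -> idl (f - normal_part k f).
Proof.
rewrite inE => /allP fP.
have -> : f - normal_part k f =
    \sum_(w <- msupp f) (<< w >> - normal_part k << w >>) *~ f@_w.
  under [RHS]eq_bigr do rewrite mulrzBl; rewrite sumrB -malg_sumU; congr (_ - _).
  rewrite /normal_part; under [RHS]eq_bigr do rewrite mulrz_suml.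
  rewrite exchange_big /=; apply: eq_bigr => c _.
  by rewrite eval_atE mulrz_sumr; apply: eq_bigr => w _; rewrite eval_at_word mulrzz mulrzA.
rewrite big_seq; apply: ideal_sum => w wf; apply: idealMz.
by have /and3P[w1 /eqP wk _] := fP _ wf; exact: normal_part_word.
Qed.

Lemma normal_form_homog k l x t : size t = k -> is_simplex D k l (critical x t) ->
  normal_form x t \in hom_part k l.
Proof.
move=> sz; rewrite (@is_simplexE _ d R) => /and3P[_ _ /eqP lE].
have : eval_at (critical x t) (normal_form x t) != 0 by rewrite normal_form_critical1.
have [w w1 ->] := normal_form_word x t; rewrite eval_at_word => /word_val_supp[].
rewrite size_critical sz => -[kE] pE.
rewrite inE msuppU1; apply/allP => w'; rewrite inE => /eqP ->.
by rewrite w1 /= word_deglE -pE lE eqxx andbT; apply/eqP.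
Qed.

Local Notation FP k l := (free_part (@gen_degk n m) (@gen_degl n m R) k l).
Local Notation PR k l :=
  (presented (@gen_degk n m) (@gen_degl n m R) (@cycle_rels n m) k l).

Lemma eval_at_is_cocycle k l f : is_cocycle (@cochain_of _ d R k l (eval_at^~ f)).
Proof.
rewrite -[is_cocycle _]/(cobound _ == 0); apply/eqP/hom_malgP => s.
rewrite (cobound_cochain_of dist_eq0) eval_at_cocycle //.
by have := valP s; rewrite (@is_simplexE _ d R) => /and3P[].
Qed.

Definition cocycle_of k l (f : FP k l) : cocycle D k l :=
  exist _ (@cochain_of _ d R k l (eval_at^~ (val f))) (eval_at_is_cocycle k l (val f)).

Lemma cocycle_ofB k l : zmod_morphism (@cocycle_of k l).
Proof.
move=> f g; apply/val_inj/hom_malgP => s.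
rewrite [in RHS]raddfB homDE homNE !fgextU.
by rewrite [val (f - g)]raddfB (raddfB (eval_at _)).
Qed.

Lemma cocycle_of_chain k l (f : FP k l) s : val (cocycle_of f) (chain_at k l s) =
  if is_simplex D k l s then eval_at s (val f) else 0.
Proof. exact: cochain_ofE. Qed.

Lemma cocycle_ofE k l (f : FP k l) s : sorted neqr s ->
  val (cocycle_of f) (chain_at k l s) = eval_at s (val f).
Proof.
move=> so; rewrite cocycle_of_chain; case: ifP => // nS.
apply/esym/eqP; apply: contraFT nS => /(eval_at_homog (valP f))[sz lE].
by rewrite (@is_simplexE _ d R) sz so lE !eqxx.
Qed.

(** So evaluation at the critical simplices embeds cohomology into functions of them. *)
Lemma coboundary_critical k l (p : cocycle D k l) :
  (forall x t, size t = k -> val p (chain_at k l (critical x t)) = 0) <->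
  is_coboundary (val p).
Proof.
split=> [H|H x t _]; last by apply: coboundary_rigid H _; exact: critical_rigid.
have [psi psiE] : exists psi, forall s, sorted neqr s -> size s = k.+1 ->
    val p (chain_at k l s) = codiff d psi s.
  apply: cocycle_exact => // s so sz.
  by rewrite -cobound_codiff // (eqP (valP p)) hom0E.
by have := is_coboundary_of dist_eq0 l psiE; rewrite cochain_of_eval.
Qed.

(** The direction from left to right is injectivity of the final map: if all
coefficients of [normal_part] vanish, then f is congruent to 0. *)
Lemma cocycle_of_coboundary k l (f : FP k l) :
  is_coboundary (val (cocycle_of f)) <-> idl (val f).
Proof.
rewrite -coboundary_critical; split=> H.
  rewrite -[val f](subrK (normal_part k (val f))); apply: idealD.
    exact: normal_part_homog (valP f).
  rewrite /normal_part big1 => [|[x t] _]; [exact: ideal0 | rewrite [fst _]/= [snd _]/=].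
  by rewrite -cocycle_ofE ?critical_sorted // H ?mulr0z // size_tuple.
move=> x t _; rewrite cocycle_ofE ?critical_sorted //.
by apply: ideal_rigid H _ _; [exact: critical_sorted | exact: critical_rigid].
Qed.

Local Open Scope quotient_scope.

Definition mag_map k l (x : PR k l) : MH D k l := \pi_(MH D k l) (cocycle_of (repr x)).

Lemma mag_map_pi k l (f : FP k l) :
  mag_map (\pi_(PR k l) f) = \pi_(MH D k l) (cocycle_of f).
Proof.
apply/eqP; rewrite /mag_map -Quotient.idealrBE -cocycle_ofB.
apply/asboolP/cocycle_of_coboundary; apply/asboolP.
by rewrite -[X in is_true X]/(_ \in @ideal_part _ _ _ _ _ k l) Quotient.idealrBE reprK.
Qed.

Lemma mag_mapB k l : zmod_morphism (@mag_map k l).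
Proof.
elim/quotW => f; elim/quotW => g.
by rewrite -raddfB !mag_map_pi cocycle_ofB raddfB.
Qed.

HB.instance Definition _ k l :=
  GRing.isZmodMorphism.Build (PR k l) (MH D k l) (@mag_map k l) (@mag_mapB k l).

Lemma mag_map_inj k l : injective (@mag_map k l).
Proof.
apply: raddf_inj; elim/quotW => f f0.
have {}f0 : \pi_(MH D k l) (cocycle_of f) == \pi_(MH D k l) 0.
  by rewrite -mag_map_pi raddf0; apply/eqP.
suff /eqP : \pi_(PR k l) f == \pi_(PR k l) 0 by rewrite raddf0.
move: f0; rewrite -!Quotient.idealrBE !subr0 => /asboolP H; apply/asboolP.
exact/cocycle_of_coboundary.
Qed.

(** The preimage is the combination of normal forms with the values of the cocycle q at
the critical simplices as coefficients. *)
Lemma mag_map_surj k l (y : MH D k l) : exists x, mag_map x = y.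
Proof.
elim/quotW: y => q.
pose f : A := \sum_(c : X * k.-tuple bool | is_simplex D k l (critical c.1 c.2))
  normal_form c.1 c.2 *~ val q (chain_at k l (critical c.1 c.2)).
have fh : f \in hom_part k l.
  apply: rpred_sum => c cS; apply: rpredMz; apply: normal_form_homog cS.
  exact: size_tuple.
pose p : FP k l := exist _ f fh; exists (\pi_(PR k l) p); rewrite mag_map_pi.
apply/eqP; rewrite -Quotient.idealrBE; apply/asboolP/coboundary_critical => x t sz.
rewrite [val (cocycle_of p - q)]raddfB homDE homNE cocycle_of_chain.
case: ifP => cS; last by rewrite simplex_chainN // raddf0 subr0.
have /eqP sz' := sz; have -> : val p = f by [].
rewrite /f (raddf_sum (eval_at _)) (bigD1 (x, Tuple sz')) //=.
rewrite (raddfMz (eval_at _)) /= normal_form_critical1 big1 => [|c /andP[_ cn]].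
  by rewrite addr0 intz subrr.
rewrite (raddfMz (eval_at _)) /= normal_form_critical.
case: eqP => [[c1 c2]|_]; last by rewrite mul0rz.
case/negP: cn; apply/eqP; case: c c1 c2 => c1 c2 /= -> E.
by congr pair; apply: val_inj.
Qed.

Lemma mag_map_bij k l : bijective (@mag_map k l).
Proof.
have [g gK] := choice (@mag_map_surj k l).
by exists g => // x; apply: mag_map_inj; rewrite gK.
Qed.

Lemma mag_mapM k1 k2 l1 l2 (x : PR k1 l1) (y : PR k2 l2) :
  mag_map (presented_mul x y) = MH_mul (mag_map x) (mag_map y).
Proof.
elim/quotW: x => f; elim/quotW: y => g.
rewrite presented_mul_pi !mag_map_pi MH_mul_pi; congr (\pi _).
apply/val_inj/hom_malgP => s; rewrite !fgextU /cup_fun.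
have so : sorted neqr (val s).
  by have := valP s; rewrite (@is_simplexE _ d R) => /and3P[].
rewrite !cocycle_ofE; [|exact: drop_sorted|exact: take_sorted].
exact: eval_at_homogM (valP f).
Qed.

End Grading.

End OddCycle.

Theorem theorem7p1 (R : realType) (m n : nat)
    (hm : (2 <= m)%N) (hn : n = (2 * m + 1)%N) :
  exists f : forall (k : nat) (l : R),
      {additive presented (@gen_degk n m) (@gen_degl n m R) (@cycle_rels n m) k l
        -> MH (@cycle_metric n R) k l},
    (forall (k : nat) (l : R), bijective (f k l)) /\
    (forall (k1 k2 : nat) (l1 l2 : R)
        (x : presented (@gen_degk n m) (@gen_degl n m R) (@cycle_rels n m) k1 l1)
        (y : presented (@gen_degk n m) (@gen_degl n m R) (@cycle_rels n m) k2 l2),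
      f (k1 + k2)%N (l1 + l2) (presented_mul x y)
      = MH_mul (f k1 l1 x) (f k2 l2 y)).
Proof.
exists (fun k l => @mag_map m n hm hn R k l); split.
  exact: mag_map_bij.
exact: mag_mapM.
Qed.
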